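(* Let $n\ge 1$ be an integer and, for integers $k\ge 0$ and $0\le \ell\le n$, let $\mathrm{Vol}^{(n)}_{k,\ell}$ denote the volume of the set of bead configurations on $n$ unit-length strings with $k$ beads per string and occupation number $\ell$. Then for all $\lambda,T\in\mathbb{C}$, $$\sum_{k\ge 0}\ \sum_{0\le \ell\le n} T^{nk}e^{-\lambda \ell}\,\mathrm{Vol}^{(n)}_{k,\ell}=\frac12\sum_{\theta=(\theta_1,\theta_2)\in\{0,1\}^2}(-1)^{(\theta_1+1)(\theta_2+n+1)}\prod_{w\in\mathbb{C}:\ w^n=(-1)^{\theta_2}}\left(e^{Tw}-(-1)^{\theta_1}e^{-\lambda}\right).$$
   Context: Let $\mathbb{Z}_n=\mathbb{Z}/n\mathbb{Z}$ and $\mathbb{T}_n=[0,1)\times\mathbb{Z}_n$ ($n$ strings, each a circle of unit length). For $k\ge1$, a bead configuration with $k$ beads per string is a collection of $nk$ distinct points (beads) of $\mathbb{T}_n$, with $k$ on each string $[0,1)\times\{h\}$, such that for every $h\in\mathbb{Z}_n$, if $t_1<\dots<t_k$ are the beads on string $h$ and $t_1'<\dots<t_k'$ are the beads on string $h+1$ (mod $n$), then either $t_1\le t_1'<t_2\le t_2'<\dots<t_k\le t_k'$ or $t_1'<t_1\le t_2'<t_2\le\dots\le t_k'<t_k$. Occupation process and occupation number: for each bead $(t,h)$ let $u\in[0,1)$ be the smallest number such that $(t+u \bmod 1,\,h+1)$ is a bead; string $h+1$ is declared occupied at the times $t+v \bmod 1$ for $0\le v<u$. Let $X_t\subseteq\mathbb{Z}_n$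 be the set of strings occupied at time $t$ (in this way). The cardinality of $X_t$ does not depend on $t$, and it is called the occupation number $\ell$ of the configuration. A configuration with $k$ beads per string and occupation number $\ell$ is called an $(n,k,\ell)$ configuration. For $k\ge1$, writing $t_{1,h}<\dots<t_{k,h}$ for the positions of the beads on string $h$, the set of $(n,k,\ell)$ configurations is identified with a subset $\mathcal{W}^{(n)}_{k,\ell}$ of $[0,1)^{nk}$ (the set of arrays $(t_{i,h})_{1\le i\le k,\,h\in\mathbb{Z}_n}$, increasing in $i$, that form an $(n,k,\ell)$ configuration), and $\mathrm{Vol}^{(n)}_{k,\ell}$ is its $nk$-dimensional Lebesgue measure. For $k=0$ there are no beads and the occupation process is constant, equal to an arbitrary subset of $\mathbb{Z}_n$ whose cardinality is $\ell$; accordingly $\mathrm{Vol}^{(n)}_{0,\ell}=\binom{n}{\ell}$. *)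

(* Defs.v *)
From HB Require Import structures.
From mathcomp Require Import all_boot all_order all_algebra.
From mathcomp Require Import all_classical all_reals all_analysis.
From mathcomp Require Import complex.

Set Implicit Arguments.
Unset Strict Implicit.
Unset Printing Implicit Defensive.

Import Order.TTheory GRing.Theory Num.Theory.
Import numFieldNormedType.Exports.

Local Open Scope classical_set_scope.
Local Open Scope ring_scope.

Definition cexp (R : realType) (z : R[i]) : R[i] :=
  (expR (complex.Re z))%:C%C *
  (cos (complex.Im z) +i* sin (complex.Im z))%C.

(* The product of N copies of [lebesgue_measure], on Borel subsets of R^N. *)
Fixpoint lebesgue_tuple (R : realType) (N : nat) :
    set (N.-tuple (measurableTypeR R)) -> \bar R :=
  if N is N'.+1 then
    pushforward (@lebesgue_measure R \x @lebesgue_tuple R N')%E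
      (fun p => [tuple of p.1 :: p.2])
  else dirac [tuple].

Section lebesgue_tuple_measure.
Context (R : realType).
Local Notation RN N := (N.-tuple (measurableTypeR R)).

Let consR N (p : measurableTypeR R * RN N) : RN N.+1 := [tuple of p.1 :: p.2].

Let measurable_consR N : measurable_fun setT (@consR N).
Proof. by apply: measurable_cons; [exact: measurable_fst|exact: measurable_snd]. Qed.

Let unconsR N (t : RN N.+1) : measurableTypeR R * RN N :=
  (thead t, [tuple of behead t]).

Let measurable_unconsR N : measurable_fun setT (@unconsR N).
Proof.
apply/measurable_fun_pairP; split.
  exact: (measurable_tnth ord0).
exact: measurable_behead.
Qed.

Let consRK N : cancel (@consR N) (@unconsR N).
Proof.
by case=> x t; rewrite /unconsR theadE; congr pair; apply/val_inj.
Qed.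

Let consR_sigma_finite N (m : {sigma_finite_measure set (RN N) -> \bar R}) :
  sigma_finite setT (pushforward (@lebesgue_measure R \x m)%E (@consR N)).
Proof.
have /sigma_finiteP[F [TF ndF Foo]] := sigma_finiteT (@lebesgue_measure R).
have /sigma_finiteP[G [TG ndG Goo]] := sigma_finiteT m.
exists (fun j => @unconsR N @^-1` (F j `*` G j)).
  apply/seteqP; split => // t _.
  have [a _ Fa] : (\bigcup_i F i) (unconsR t).1 by rewrite -TF.
  have [b _ Gb] : (\bigcup_i G i) (unconsR t).2 by rewrite -TG.
  exists (maxn a b) => //; split.
    by move: Fa; apply/subsetPset/ndF/leq_maxl.
  by move: Gb; apply/subsetPset/ndG/leq_maxr.
move=> j; have [mF ooF] := Foo j; have [mG ooG] := Goo j; split.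
  rewrite -[X in measurable X]setTI; apply: measurable_unconsR => //.
  exact: measurableX.
rewrite /pushforward -comp_preimage (_ : _ \o _ = id) ?preimage_id.
  by rewrite product_measure1E// lte_mul_pinfty// ge0_fin_numE.
by apply/funext => p /=; rewrite consRK.
Qed.

Let lebesgue_tuple_sfm N :
  exists m : {sigma_finite_measure set (RN N) -> \bar R},
    @lebesgue_tuple R N = m :> (set _ -> _).
Proof.
elim: N => [|N [m mE]].
  by exists (@dirac _ (RN 0) [tuple] R : {sigma_finite_measure set _ -> \bar R}).
pose q : {measure set (RN N.+1) -> \bar R} :=
  measure_function_pushforward__canonical__measure_function_Measure
    (@lebesgue_measure R \x m)%E (@measurable_consR N).
pose q_sf := Measure_isSigmaFinite.Build _ _ _ q (consR_sigma_finite m).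
pose qs : {sigma_finite_measure set (RN N.+1) -> \bar R} :=
  HB.pack (q : set (RN N.+1) -> \bar R) q q_sf.
by exists qs; rewrite /= mE.
Qed.

Let lebesgue_tuple0 N : @lebesgue_tuple R N set0 = 0%E.
Proof. by have [m ->] := lebesgue_tuple_sfm N. Qed.

Let lebesgue_tuple_ge0 N A : (0 <= @lebesgue_tuple R N A)%E.
Proof. by have [m ->] := lebesgue_tuple_sfm N. Qed.

Let lebesgue_tuple_sigma_additive N : semi_sigma_additive (@lebesgue_tuple R N).
Proof.
by have [m ->] := lebesgue_tuple_sfm N; exact: measure_semi_sigma_additive.
Qed.

HB.instance Definition _ N := isMeasure.Build _ _ _ (@lebesgue_tuple R N)
  (lebesgue_tuple0 N) (@lebesgue_tuple_ge0 N) (@lebesgue_tuple_sigma_additive N).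

Let lebesgue_tuple_sigma_finite N : sigma_finite setT (@lebesgue_tuple R N).
Proof. by have [m ->] := lebesgue_tuple_sfm N; exact: sigma_finiteT. Qed.

HB.instance Definition _ N := Measure_isSigmaFinite.Build _ _ _
  (@lebesgue_tuple R N) (lebesgue_tuple_sigma_finite N).

Lemma lebesgue_tuple_box N (A : 'I_N -> set (measurableTypeR R)) :
  (forall i, measurable (A i)) ->
  @lebesgue_tuple R N [set t | forall i, A i (tnth t i)] =
  (\prod_(i < N) lebesgue_measure (A i))%E.
Proof.
elim: N A => [|N IH] A mA.
  by rewrite big_ord0 /= diracE mem_set//= => -[].
rewrite big_ord_recl -IH// /= /pushforward.
set B := [set t : RN N | _].
have mB : measurable B.
  rewrite (_ : B = \bigcap_(i in [set: 'I_N]) (@tnth _ _ ^~ i @^-1` A (lift ord0 i))).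
    apply: fin_bigcap_measurable => [|i _]; first exact: finite_finset.
    by rewrite -[X in measurable X]setTI; exact: measurable_tnth.
  by apply/seteqP; split => [t Bt i _|t Bt i]; [exact: Bt|exact: (Bt i)].
rewrite -product_measure1E//; congr product_measure1.
apply/seteqP; split => -[x t] /= H.
  split; first by have := H ord0; rewrite tnth0.
  by move=> i /=; have := H (lift ord0 i); rewrite tnthS.
move=> i; case: (unliftP ord0 i) => [j ->|->]; first by rewrite tnthS; apply: H.2.
by rewrite tnth0; exact: H.1.
Qed.

End lebesgue_tuple_measure.

Section bead_configurations.
Context (R : realType) (n k : nat).
Implicit Types (t : 'M[R]_(n, k)) (h : 'I_n).

(* In an array t, the entry t h i is the position of the bead number i (counted
   from 0) of string h; the string h + 1 mod n is [ordS h]. *)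

Definition interlacing (a b : 'I_k -> R) : Prop :=
  ((forall i, a i <= b i) /\
   (forall i j : 'I_k, j = i.+1 :> nat -> b i < a j)) \/
  ((forall i, b i < a i) /\
   (forall i j : 'I_k, j = i.+1 :> nat -> a i <= b j)).

Definition bead_config t : Prop :=
  [/\ forall h i, 0 <= t h i < 1,
      forall h (i j : 'I_k), (i < j)%N -> t h i < t h j
    & forall h, interlacing (t h) (t (ordS h))].

Definition is_bead t (s : R) h : Prop := exists i, t h i = s.

Definition mod1 (x : R) : R := x - (Num.floor x)%:~R.

Definition next_bead_delay t (s : R) h (u : R) : Prop :=
  [/\ 0 <= u < 1, is_bead t (mod1 (s + u)) (ordS h)
    & forall v, 0 <= v < 1 -> is_bead t (mod1 (s + v)) (ordS h) -> u <= v].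

Definition occupied t (s : R) h : Prop :=
  exists h' i u v, [/\ h = ordS h', next_bead_delay t (t h' i) h' u,
    0 <= v < u & s = mod1 (t h' i + v)].

Definition occupation_set t (s : R) : {set 'I_n} := [set h | `[< occupied t s h >]].

Definition occupation_number t (l : nat) : Prop :=
  forall s, 0 <= s < 1 -> #|occupation_set t s| = l.

Definition nkl_config (l : nat) : set 'M[R]_(n, k) :=
  [set t | bead_config t /\ occupation_number t l].

Definition array_of_tuple (x : (n * k).-tuple (measurableTypeR R)) :
    'M[R]_(n, k) :=
  \matrix_(h, i) tnth x (mxvec_index h i).

(* The volume is finite, being that of a subset of the unit cube. *)
Definition bead_volume (l : nat) : R :=
  if k == 0%N then 'C(n, l)%:R
  else fine (lebesgue_tuple (array_of_tuple @^-1` nkl_config l)).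

End bead_configurations.

(* Main.v *)
(* Read in time, a bead configuration is a closed path of exclusion particles:
   a bead on string h moves the hole (unoccupied string) at h + 1 to h. Up to a
   null set an array is determined by the order type of its nk entries, and each
   order type has volume 1/(nk)!, so (nk)! Vol_{k,l} counts the closed words of
   length nk of the hole process with n - l holes. This process is free
   fermionic: with m holes it is diagonalised by Slater determinants in the m-subsets
   J of the n-th roots w of (-1)^(m+1), with eigenvalue sum_J w, so the number of
   closed words of length N is sum_J (sum_J w)^N. Summing T^N/N! gives the m-th
   elementary symmetric polynomial of the e^(Tw), and the average over theta_1
   selects theta_2 = m + 1 modulo 2 in the coefficient of e^(-lambda (n - m)). *)

Require Import Defs.
From HB Require Import structures.
From mathcomp Require Import all_boot all_order all_algebra.
From mathcomp Require Import all_classical all_reals all_analysis.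
From mathcomp Require Import complex measurable_realfun.
From mathcomp Require Import perm separable cyclotomic zify ring lra.

Import Order.TTheory GRing.Theory Num.Theory.
Import numFieldNormedType.Exports.

Set Implicit Arguments.
Unset Strict Implicit.
Unset Printing Implicit Defensive.

(** * Determinants and sums over subsets *)

(** No eigenspaces are handled: the number of words between two hole sets is written as a sum of
    products of Slater determinants and checked by induction on the length, completeness entering
    only at length 0. Holes are labelled and sums run over all maps from labels to strings, so a
    factor m! replaces the choice of an order, and collisions of holes disappear as determinants
    with two equal rows. The occupation number meets the holes through the two interlacing
    alternatives of neighbouring strings [h] and [h + 1]: before any bead, string [h + 1] is
    occupied exactly in the second one. The order type thus fixes the initial hole set, and the
    occupation number counts the second alternatives. Volumes involve only the lengths nk, an
    exponential series all lengths. The other lengths contribute nothing, because each hop lowers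
    the sum of the hole positions by one modulo n. *)

Lemma sum_injective_image (V : nmodType) (m n : nat) (g : {set 'I_n} -> V) :
  (\sum_(y : {ffun 'I_m -> 'I_n} | injectiveb y) g (y @: [set: 'I_m])%SET =
   (\sum_(Y : {set 'I_n} | #|Y| == m) g Y) *+ m`!)%R.
Proof.
rewrite (partition_big (fun y : {ffun _} => y @: [set: 'I_m])%SET
  (fun Y => #|Y| == m)) /=; last first.
  move=> y /injectiveP yi; rewrite card_imset// cardsT card_ord//.
rewrite -sumrMnl; apply: eq_bigr => Y /eqP cY.
rewrite (eq_bigr (fun=> g Y)); last by move=> y /andP[_ /eqP->].
rewrite sumr_const; congr (_ *+ _)%R.
transitivity (#|[set f in ffun_on Y | injectiveb (f : {ffun 'I_m -> 'I_n})]|).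
  apply: eq_card => y; rewrite !inE [LHS]unfold_in andbC.
  apply: andb_id2r => /injectiveP yi.
  apply/eqP/ffun_onP => [<- i|yY]; first exact: imset_f.
  apply/eqP; rewrite eqEcard card_imset// cardsT card_ord cY leqnn andbT.
  by apply/fintype.subsetP => _ /imsetP[i _ ->]; exact: yY.
by rewrite card_inj_ffuns_on cY card_ord ffactnn.
Qed.

Section Determinants.
Local Open Scope ring_scope.

(* The Cauchy-Binet formula, with the sum over [m]-subsets replaced by a sum
   over all maps, each subset being counted [m!] times. *)
Lemma sum_det_ffun (F : comNzRingType) (m p : nat) (A B : 'I_m -> 'I_p -> F) :
  \sum_(f : {ffun 'I_m -> 'I_p})
    \det (\matrix_(i, j) A i (f j)) * \det (\matrix_(i, j) B i (f j)) =
  m`!%:R * \det (\matrix_(i, j) \sum_q A i q * B j q).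
Proof.
pose D (g : {ffun 'I_m -> 'I_p}) : F := \det (\matrix_(i, j) B i (g j)).
pose P (g : {ffun 'I_m -> 'I_p}) : F := \prod_i A i (g i).
have -> : \det (\matrix_(i, j) \sum_q A i q * B j q) = \sum_g P g * D g.
  rewrite /determinant.
  under eq_bigr => s _.
    under eq_bigr => i _ do rewrite mxE.
    rewrite bigA_distr_bigA /= mulr_sumr; over.
  rewrite exchange_big /=; apply: eq_bigr => g _.
  rewrite /D -det_tr /determinant mulr_sumr; apply: eq_bigr => s _.
  by under [X in _ = _ * (_ * X)]eq_bigr => i _ do rewrite !mxE; rewrite big_split /= mulrCA.
rewrite mulr_natl.
have Dperm (s : 'S_m) (g : {ffun 'I_m -> 'I_p}) : D [ffun i => g (s i)] = (-1) ^+ s * D g.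
  have -> : (-1) ^+ s = \det (perm_mx s) :> F by rewrite det_perm.
  rewrite -[in RHS](det_tr (perm_mx s)) tr_perm_mx mulrC -det_mulmx -col_permE /D.
  by congr determinant; apply/matrixP => i j; rewrite !mxE ffunE ?invgK.
transitivity (\sum_(s : 'S_m) \sum_g P g * D g); last first.
  by rewrite sumr_const card_Sn.
under eq_bigr => f _ do rewrite [X in X * _]/determinant mulr_suml.
rewrite exchange_big /=; apply: eq_bigr => s _.
(* With f = g o s^-1 the product of the [A] no longer depends on [s], and the sign produced by [D]
   cancels that of [s]; hence all m! permutations contribute equally. *)
rewrite (reindex (fun g : {ffun 'I_m -> 'I_p} => [ffun i => g ((s^-1)%g i)])) /=; last first.
  exists (fun g : {ffun 'I_m -> 'I_p} => [ffun i => g (s i)]) => g _;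
  by apply/ffunP => i; rewrite !ffunE ?permK ?permKV.
apply: eq_bigr => g _; rewrite -/(D _) Dperm odd_permV mulrACA -expr2 sqrr_sign.
rewrite mul1r; congr (_ * _); apply: eq_bigr => i _.
by rewrite mxE ffunE permK.
Qed.

(** In the Leibniz term of [s], scaling row [i] contributes [d (s i)], and the sum over [i] runs
    through all columns. This turns the eigenvalue of a Slater determinant into a sum over moves of
    a single hole. *)
Lemma sum_det_scale_row (F : comNzRingType) (m : nat) (A : 'M[F]_m) (d : 'I_m -> F) :
  \sum_i \det (\matrix_(i', j) (if i' == i then d j * A i' j else A i' j)) =
  (\sum_j d j) * \det A.
Proof.
rewrite /determinant exchange_big /= mulr_sumr; apply: eq_bigr => s _.
rewrite -mulr_sumr mulrCA; congr (_ * _).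
rewrite [in RHS](reindex_inj (@perm_inj _ s)) /= mulr_suml; apply: eq_bigr => i _.
rewrite (bigD1 i)//= mxE eqxx (bigD1 i (P := xpredT))//= mulrA; congr (_ * _).
by apply: eq_bigr => j /negbTE ji; rewrite mxE ji.
Qed.

End Determinants.

(** * The hole process and its diagonalisation *)

Section Walks.
Variable n : nat.
Implicit Types (Y Z : {set 'I_n}) (h : 'I_n).

(* [Y] is the set of unoccupied strings: a bead on string [h] moves the hole on
   string [h + 1] to string [h]. For [n = 1] the hole stays where it is. *)
Definition hop Y h : option {set 'I_n} :=
  if (ordS h \in Y) && (h \notin Y :\ ordS h) then Some (h |: (Y :\ ordS h))
  else None.

Fixpoint run Y (s : seq 'I_n) : option {set 'I_n} :=
  if s is h :: s' then obind (run^~ s') (hop Y h) else Some Y.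

Definition walks N Y Z := #|[set s : N.-tuple 'I_n | run Y s == Some Z]|.

Lemma walks0 Y Z : walks 0 Y Z = (Y == Z).
Proof.
rewrite /walks; case: eqP => [->|YZ] /=.
  rewrite -[RHS](card_tuple 0 'I_n) -cardsT; apply: eq_card => s.
  by rewrite !inE tuple0 eqxx.
by apply: eq_card0 => s; rewrite !inE tuple0/=; apply/eqP => -[].
Qed.

Lemma walksS N Y Z :
  walks N.+1 Y Z = \sum_h (if hop Y h is Some Y' then walks N Y' Z else 0).
Proof.
rewrite /walks -sum1_card (partition_big (@thead N 'I_n) xpredT) //=.
apply: eq_bigr => h _; rewrite sum1_card.
case E: (hop Y h) => [Y'|]; last first.
  by apply: eq_card0 => t; rewrite [LHS]unfold_in inE; case/tupleP: t => x t /=;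
    apply/negbTE/negP => /andP[/[swap] /eqP]; rewrite theadE => ->; rewrite E.
rewrite -[RHS](@card_imset _ _ (fun t : N.-tuple 'I_n => [tuple of h :: t])); last first.
  by move=> s t /(congr1 val) [] /val_inj.
apply: eq_card => t; rewrite [LHS]unfold_in inE; case/tupleP: t => x t.
rewrite theadE /=; apply/andP/imsetP => [[/[swap] /eqP ->]|[u]].
  by rewrite E /= => ut; exists t; rewrite ?inE.
by rewrite inE => /eqP ru /(congr1 val) [-> tu]; rewrite tu E /= ru.
Qed.

(** The invariant that forces closed walks to have length divisible by [n]. *)
Lemma hop_sum Y Y' h : hop Y h = Some Y' ->
  (\sum_(i in Y') i + 1 = \sum_(i in Y) i %[mod n])%N.
Proof.
rewrite /hop; case: ifP => // /andP[hY hN] [<-].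
rewrite big_setU1//= [in RHS](big_setD1 _ hY) /= addnAC modnDml.
by rewrite -modnDml addn1 modnDml.
Qed.

Lemma run_sum Y Z s : run Y s = Some Z ->
  (\sum_(i in Z) i + size s = \sum_(i in Y) i %[mod n])%N.
Proof.
elim: s Y => [|h s IH] Y /=; first by case=> ->; rewrite addn0.
case E: (hop Y h) => [Y'|] //= /IH H; rewrite -(hop_sum E).
by rewrite -addn1 addnA -modnDml H modnDml.
Qed.

Lemma walks_closed_dvdn N Y : ~~ (n %| N) -> walks N Y Y = 0.
Proof.
move=> nN; apply: eq_card0 => s; rewrite !inE; apply/negbTE/eqP => /run_sum.
rewrite size_tuple -{2}[(\sum_(i in Y) i)%N]addn0 => /eqP.
by rewrite eqn_modDl mod0n; apply/negP.
Qed.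

End Walks.

Lemma ord_pred_val n (j : 'I_n) :
  ord_pred j = (if j == 0 :> nat then n.-1 else j.-1) :> nat.
Proof.
case: j => -[|j] jn /=; first by rewrite add0n modn_small ?prednK.
by rewrite /= modnDr modn_small// ltnW.
Qed.

Section Slater.
Local Open Scope ring_scope.
Variables (m n : nat).
Implicit Types (y z : {ffun 'I_m -> 'I_n}).

(* Multiplied by this sign, an alternating function of the positions of the holes
   becomes a function of the set of holes. A hole jumping from string 0 to string
   [n - 1] passes the [m - 1] other ones, whence the twist [w ^+ n = (-1) ^+ m.+1]. *)
Definition order_sign y : int :=
  Num.sg (\prod_(i < m) \prod_(j < m | (i < j)%N) ((y j)%:Z - (y i)%:Z)).

Lemma order_sign_sqr y : injectiveb y -> order_sign y ^+ 2 = 1.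
Proof.
move=> /injectiveP yi; rewrite /order_sign sqr_sg.
set b := (_ != 0); suff -> : b by [].
apply/prodf_neq0 => i _; apply/prodf_neq0 => j ij.
by rewrite subr_eq0; apply: contraTN ij => /eqP[/val_inj/yi ->]; rewrite ltnn.
Qed.

(** The product of differences is a Vandermonde determinant, so permuting the holes permutes its
    columns. *)
Lemma order_sign_perm y (s : 'S_m) :
  order_sign [ffun i => y (s i)] = (-1) ^+ s * order_sign y.
Proof.
pose V (z : {ffun 'I_m -> 'I_n}) := Vandermonde m (\row_i (z i)%:Z).
have E z : order_sign z = Num.sg (\det (V z)).
  rewrite det_Vandermonde /order_sign; congr (Num.sg _).
  by apply: eq_bigr => i _; apply: eq_bigr => j _; rewrite !mxE.
rewrite !E.
have -> : V [ffun i => y (s i)] = V y *m (perm_mx s)^T.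
  by rewrite tr_perm_mx -col_permE; apply/matrixP => i j; rewrite !mxE ffunE.
by rewrite det_mulmx det_tr det_perm mulrC sgrM sgrX sgrN sgr1.
Qed.

(** A step by one cannot overtake another hole without landing on it, which injectivity of [z]
    forbids; only the wrap from 0 to [n - 1] reverses order, and it does so for every pair
    containing [i]. *)
Lemma order_sign_hop y (i : 'I_m) (z := [ffun j : 'I_m => if j == i then ord_pred (y i) else y j]) :
  injectiveb y -> injectiveb z ->
  order_sign z = (if y i == 0%N :> nat then (-1) ^+ m.-1 else 1) * order_sign y.
Proof.
move=> /injectiveP yi /injectiveP zi; rewrite /order_sign.
pose e : int := if y i == 0%N :> nat then -1 else 1.
have sgz (a b : 'I_m) : (a < b)%N ->
    Num.sg ((z b)%:Z - (z a)%:Z) = e ^+ ((a == i) + (b == i)) * Num.sg ((y b)%:Z - (y a)%:Z).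
  have sgB (p q : nat) : Num.sg (q%:Z - p%:Z) =
      if (p < q)%N then 1 else if (q < p)%N then -1 else 0.
    by case: ltngtP => pq; [apply: gtr0_sg|apply: ltr0_sg|rewrite pq subrr sgr0]; lia.
  move=> ab; have nab : a != b by apply: contraTneq ab => ->; rewrite ltnn.
  have yab : (y a != y b :> nat) by apply: contra nab => /eqP /val_inj /yi /eqP.
  have zab : (z a != z b :> nat) by apply: contra nab => /eqP /val_inj /zi /eqP.
  have := ltn_ord (y a); have := ltn_ord (y b).
  move: yab zab; rewrite !sgB !ffunE.
  have [ai|ai] := eqVneq a i.
    have -> : (b == i) = false by apply/negbTE; rewrite -ai eq_sym.
    rewrite -ai ord_pred_val /e -ai expr1; case: ifP => /= ya *;
    repeat case: ifP => /=; try lia.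
  have [bi|bi] := eqVneq b i.
    rewrite -bi ord_pred_val /e -bi expr1; case: ifP => /= yb *;
    repeat case: ifP => /=; try lia.
  by rewrite expr0 mul1r.
have -> : (if y i == 0%N :> nat then (-1) ^+ m.-1 else 1) = e ^+ m.-1.
  by rewrite /e; case: ifP => //; rewrite expr1n.
rewrite !(big_morph _ (@sgrM int) (@sgr1 int)).
under eq_bigr => a _ do rewrite (big_morph _ (@sgrM int) (@sgr1 int)).
under [in RHS]eq_bigr => a _ do rewrite (big_morph _ (@sgrM int) (@sgr1 int)).
(* The index [i] belongs to exactly [m.-1] of the pairs a < b. *)
have -> : e ^+ m.-1 = \prod_(a < m) \prod_(b < m | (a < b)%N) e ^+ ((a == i) + (b == i)).
  under eq_bigr => a _ do rewrite prodrXr.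
  rewrite prodrXr; congr (_ ^+ _).
  under [RHS]eq_bigr => a _ do rewrite big_split.
  rewrite big_split /= [X in (_ + X)%N](exchange_big_dep xpredT)//= -big_split /=.
  under eq_bigr => a _.
    rewrite (_ : (_ + _)%N = \sum_(b < m | b != a) (a == i))%N; last first.
      rewrite [RHS](bigID (fun b : 'I_m => (a < b)%N))/=; congr (_ + _)%N; apply: eq_bigl => b.
        by rewrite -(inj_eq val_inj) /=; case: ltngtP.
      by rewrite -(inj_eq val_inj) /=; case: ltngtP.
    rewrite sum_nat_const (_ : #|_| = m.-1); last by rewrite cardC1 card_ord.
  over.
  by rewrite -big_distrr /= (bigD1 i)//= eqxx big1 ?muln1// => j /negbTE ->.
rewrite -big_split /=; apply: eq_bigr => a _.
by rewrite -big_split /=; apply: eq_bigr => b ab; rewrite sgz.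
Qed.

End Slater.

Section WalkCount.
Local Open Scope ring_scope.
Variables (F : numFieldType) (m n : nat) (w : 'I_n -> F).
Hypotheses (w_inj : injective w) (w_pow : forall i, w i ^+ n = (-1) ^+ m.+1).
Implicit Types (y z a : {ffun 'I_m -> 'I_n}).

Let w_neq0 i : w i != 0.
Proof.
apply/eqP => wi; have := w_pow i; rewrite wi expr0n.
by case: n i {wi} => [[]//|n' _] /eqP; rewrite eq_sym signr_eq0.
Qed.

Let sum_pos_orth (p q : 'I_n) :
  \sum_(x < n) (w p)^-1 ^+ x * w q ^+ x = n%:R * (p == q)%:R.
Proof.
under eq_bigr => x _ do rewrite -exprMn.
have [->|pq] := eqVneq p q.
  under eq_bigr => x _ do rewrite mulVf// expr1n.
  by rewrite sumr_const card_ord mulr1.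
rewrite mulr0; set r := _ * _.
have r1 : r - 1 != 0.
  rewrite subr_eq0; apply: contra pq => /eqP r1; apply/eqP/w_inj.
  by rewrite -[LHS]mulr1 -r1 /r mulVKf.
apply: (mulfI r1); rewrite mulr0 -subrX1 /r exprMn exprVn !w_pow.
by rewrite mulVf ?subrr// signr_eq0.
Qed.

(** Orthogonality over positions makes one square matrix a left inverse of another; it is then also
    a right inverse, which is orthogonality over the roots. *)
Let sum_root_orth (x x' : 'I_n) :
  \sum_q (w q)^-1 ^+ x * w q ^+ x' = n%:R * (x == x')%:R.
Proof.
have n0 : n%:R != 0 :> F by rewrite pnatr_eq0 -lt0n (leq_ltn_trans _ (ltn_ord x)).
pose P : 'M[F]_n := \matrix_(p, x) ((w p)^-1 ^+ x).
pose Q : 'M[F]_n := n%:R^-1 *: \matrix_(x, q) (w q ^+ x).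
have PQ : P *m Q = 1%:M.
  apply/matrixP => p q; rewrite -scalemxAr !mxE.
  under eq_bigr => k _ do rewrite !mxE.
  by rewrite sum_pos_orth mulKf.
have := congr1 (fun A : 'M[F]_n => n%:R * A x' x) (mulmx1C PQ).
rewrite !mxE eq_sym => <-; rewrite mulr_sumr.
by apply: eq_bigr => q _; rewrite !mxE !mulrA mulfV// mul1r mulrC.
Qed.

Let wave y a := \matrix_(i, j) (w (a j))^-1 ^+ y i.
Let dual_wave y a := \matrix_(i, j) w (a j) ^+ y i.

(* Expansion of the walk counts on the Slater determinants [wave]. *)
Let green N y z : F :=
  \sum_(a : {ffun 'I_m -> 'I_n}) (\sum_j w (a j)) ^+ N * (\det (wave y a) * \det (dual_wave z a)).

(** Cauchy-Binet leaves the determinant of the matrix with entries n [y i = z j]: it has a zero row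
    if the images differ, and is n times a permutation matrix otherwise. The constant n^m m! comes
    from here. *)
Let green0 y z : injectiveb y -> injectiveb z ->
  (order_sign y)%:~R * (order_sign z)%:~R * green 0 y z =
  (n ^ m * m`!)%:R * (y @: [set: 'I_m]%SET == z @: [set: 'I_m]%SET)%:R.
Proof.
move=> yb zb; rewrite /green.
under eq_bigr => a _ do rewrite expr0 mul1r.
rewrite (sum_det_ffun (fun i q => (w q)^-1 ^+ y i) (fun i q => w q ^+ z i)).
under eq_mx => i j do rewrite sum_root_orth.
case: eqVneq => [yz|yz]; last first.
  have [i yi] : exists i, y i \notin z @: [set: 'I_m]%SET.
    apply/existsP; apply: contraR yz => /existsPn yz.
    rewrite eqEcard !card_imset; [|exact/injectiveP..].
    rewrite leqnn andbT; apply/fintype.subsetP => _ /imsetP[i _ ->].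
    by have := yz i; rewrite negbK.
  rewrite (expand_det_row _ i) big1 ?mulr0// => j _; rewrite mxE.
  by case: eqP yi => [->|_ _]; [rewrite imset_f|rewrite mulr0 mul0r].
pose f i := odflt i [pick j | z j == y i].
have yf i : y i = z (f i).
  rewrite /f; case: pickP => [j /eqP//|zy].
  have : y i \in z @: [set: 'I_m]%SET by rewrite -yz imset_f.
  by case/imsetP => j _ yij; have := zy j; rewrite yij eqxx.
have f_inj : injective f.
  by move=> i j fij; apply: (injectiveP _ yb); rewrite !yf fij.
pose s := perm f_inj.
have -> : y = [ffun i => z (s i)] by apply/ffunP => i; rewrite ffunE permE yf.
rewrite order_sign_perm.
have -> : \matrix_(i, j) (n%:R * ([ffun i => z (s i)] i == z j)%:R) =
    n%:R *: perm_mx s :> 'M[F]_m.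
  apply/matrixP => i j; rewrite !mxE ffunE (inj_eq (injectiveP _ zb)).
  by rewrite permE.
rewrite detZ det_perm rmorphM /= rmorphXn rmorphN1 mulr1 natrM natrX.
have sz : (order_sign z)%:~R ^+ 2 = 1 :> F by rewrite -rmorphXn order_sign_sqr//= rmorph1.
have key (t u p q : F) : t * u * u * (p * (q * t)) = t ^+ 2 * u ^+ 2 * (q * p).
  by ring.
by rewrite key sz sqrr_sign !mul1r.
Qed.

Let hop_fun y i : {ffun 'I_m -> 'I_n} :=
  [ffun j => if j == i then ord_pred (y i) else y j].

(** Multiplying row [i] of [wave y a] by [w (a j)] lowers the exponent [y i] by one, that is, moves
    hole [i] one string back. If it lands on another hole, two rows agree and the term vanishes:
    this is the exclusion rule. *)
Let greenS N y z : injectiveb y ->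
  (order_sign y)%:~R * green N.+1 y z =
  \sum_i (if injectiveb (hop_fun y i)
          then (order_sign (hop_fun y i))%:~R * green N (hop_fun y i) z else 0).
Proof.
move=> yb; pose e i : F := if y i == 0%N :> nat then (-1) ^+ m.-1 else 1.
have wave_hop i a : \det (\matrix_(i', j)
    (if i' == i then w (a j) * wave y a i' j else wave y a i' j)) =
    e i * \det (wave (hop_fun y i) a).
  rewrite -[RHS]addr0 -[X in _ = _ + X](mul0r (\det (wave (hop_fun y i) a))).
  apply: (determinant_multilinear (i0 := i)).
  - apply/rowP => j; rewrite !mxE eqxx ffunE eqxx mul0r addr0 ord_pred_val /e.
    have [yi|yi] := eqVneq (y i : nat) 0%N.
      (* Wrap-around: w = w^n w^-(n-1), and w^n = (-1)^(m+1) is the sign by which [order_sign]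
         changes in this case. *)
      rewrite yi expr0 mulr1 exprVn; apply: (mulIf (expf_neq0 n.-1 (w_neq0 (a j)))).
      rewrite mulfVK ?expf_neq0// -exprS prednK ?(leq_ltn_trans _ (ltn_ord (y i)))// w_pow.
      by case: (m) (i) => [[]//|m' _]; rewrite !exprS; ring.
    rewrite mul1r; case: (y i : nat) yi => // k _.
    by rewrite exprS mulVKf.
  - by apply/matrixP => k j; rewrite !mxE ffunE eq_sym (negbTE (neq_lift i k)).
  - by apply/matrixP => k j; rewrite !mxE ffunE eq_sym (negbTE (neq_lift i k)).
transitivity (\sum_i (order_sign y)%:~R * e i * green N (hop_fun y i) z).
  rewrite /green mulr_sumr.
  under [RHS]eq_bigr => i _ do rewrite mulr_sumr.
  rewrite exchange_big /=; apply: eq_bigr => a _.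
  rewrite exprSr -!mulrA [(\sum_j _) * _]mulrA -sum_det_scale_row.
  rewrite mulr_suml !mulr_sumr; apply: eq_bigr => i _.
  by rewrite wave_hop; ring.
apply: eq_bigr => i _; case: ifPn => [zb|/injectivePn[p [q pq zpq]]].
  rewrite order_sign_hop// rmorphM /=; congr (_ * _); rewrite mulrC; congr (_ * _).
  by rewrite /e; case: ifP; rewrite ?rmorphXn ?rmorphN1 ?rmorph1.
rewrite /green big1 ?mulr0// => a _; rewrite (determinant_alternate pq) ?(mul0r, mulr0)//.
by move=> j; rewrite !mxE zpq.
Qed.

Let walks_green N y z : injectiveb y -> injectiveb z ->
  (n ^ m * m`!)%:R * (walks N (y @: [set: 'I_m]%SET) (z @: [set: 'I_m]%SET))%:R =
  (order_sign y)%:~R * (order_sign z)%:~R * green N y z.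
Proof.
move=> + zb; elim: N y => [|N IH] y yb; first by rewrite walks0 green0.
rewrite mulrAC greenS// mulr_suml walksS natr_sum mulr_sumr.
rewrite (reindex_inj (can_inj (@ord_predK n))) /=.
pose G (h : 'I_n) : F := (n ^ m * m`!)%:R * (match hop (y @: [set: 'I_m]%SET) (ord_pred h) with
  | Some Y' => walks N Y' (z @: [set: 'I_m]%SET) | None => 0%N end)%:R.
rewrite -/(\sum_h G h).
rewrite (bigID (mem (y @: [set: 'I_m]%SET))) /= [X in _ + X]big1 ?addr0; last first.
  by move=> h hY; rewrite /G /hop ord_predK (negbTE hY) mulr0.
rewrite big_imset /=; last by move=> i j _ _; exact: (injectiveP _ yb).
rewrite (eq_bigl xpredT) => [|i]; last by rewrite inE.
apply: eq_bigr => i _; rewrite /G /hop ord_predK imset_f; last by rewrite inE.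
rewrite /=.
(* The legality test of [hop] is that the moved labelling is still injective. *)
have -> : (ord_pred (y i) \notin y @: [set: 'I_m]%SET :\ y i) = injectiveb (hop_fun y i).
  apply/idP/injectiveP => [h|h].
    have hj j : j != i -> ord_pred (y i) != y j.
      move=> ji; apply: contraNneq h => ->; rewrite !inE imset_f// andbT.
      by rewrite (inj_eq (injectiveP _ yb)).
    move=> j k; rewrite !ffunE; case: eqVneq => [->|ji]; case: eqVneq => [->|ki] //.
    - by move=> /eqP; rewrite (negbTE (hj _ ki)).
    - by move=> /esym/eqP; rewrite (negbTE (hj _ ji)).
    - exact: (injectiveP _ yb).
  apply/negP; rewrite !inE => /andP[yi /imsetP[j _ yj]]; have := h i j.
  rewrite !ffunE eqxx; case: eqVneq => [ji|ji] => [_|/(_ yj) ij].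
    by move: yi; rewrite yj ji eqxx.
  by move: ji; rewrite ij eqxx.
case: ifP => [hb|_]; last by rewrite mulr0 mul0r.
rewrite mulrAC -IH//; congr (_ * (walks _ _ _)%:R).
apply/setP => h; rewrite !inE; apply/orP/imsetP => [[/eqP ->|]|[j _ ->]].
- by exists i; rewrite ?inE// ffunE eqxx.
- move=> /andP[hi /imsetP[j _ hj]]; exists j; rewrite ?inE// ffunE ifN//.
  by apply: contraNneq hi => <-; apply/eqP.
- rewrite ffunE; have [_|ji] := eqVneq j i; first by left.
  right; rewrite imset_f// andbT.
  by apply: contraNneq ji => /(injectiveP _ yb) ->.
Qed.

(** The trace of [walks_green]: Cauchy-Binet is used again, now summing over the hole positions, and
    each injective [a] yields m! n^m, which cancels the normalisation. The signs disappear since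
    [order_sign] is squared. *)
Lemma sum_closed_walks N :
  \sum_(Y : {set 'I_n} | #|Y| == m) (walks N Y Y)%:R =
  \sum_(J : {set 'I_n} | #|J| == m) (\sum_(i in J) w i) ^+ N.
Proof.
have m0 : m`!%:R != 0 :> F by rewrite pnatr_eq0 -lt0n fact_gt0.
apply: (mulfI m0); rewrite !mulr_natl -!sum_injective_image.
(* The constant vanishes only for n = 0 and m > 0, when there is no map to sum over. *)
have [/eqP c0|c0] := eqVneq ((n ^ m * m`!)%:R : F) 0.
  move: c0; rewrite pnatr_eq0 muln_eq0 expn_eq0 (negbTE (lt0n_neq0 (fact_gt0 m))) orbF.
  case/andP => n0 mp; rewrite !big1// => y _;
  have := leq_ltn_trans (leq0n _) (ltn_ord (y (Ordinal mp)));
  by rewrite lt0n n0.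
apply: (mulfI c0); rewrite !mulr_sumr.
transitivity (\sum_y green N y y).
  rewrite [RHS](bigID (fun y => injectiveb y)) /= [X in _ + X]big1 ?addr0.
    by apply: eq_bigr => y yb; rewrite walks_green// -expr2 -rmorphXn order_sign_sqr// mul1r.
  move=> y /injectivePn[p [q pq zpq]]; rewrite /green big1// => a _.
  rewrite (determinant_alternate pq) ?(mul0r, mulr0)//.
  by move=> j; rewrite !mxE zpq.
rewrite /green exchange_big /= [RHS]big_mkcond /=; apply: eq_bigr => a _.
rewrite -mulr_sumr.
have -> : \sum_y \det (wave y a) * \det (dual_wave y a) =
    m`!%:R * \det (\matrix_(i, j) \sum_(q < n) (w (a i))^-1 ^+ q * w (a j) ^+ q).
  rewrite -(sum_det_ffun (fun i (q : 'I_n) => (w (a i))^-1 ^+ q) (fun i q => w (a i) ^+ q)).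
  by apply: eq_bigr => y _; rewrite -[\det (wave y a)]det_tr -[\det (dual_wave y a)]det_tr;
    congr (_ * _); congr determinant; apply/matrixP => i j; rewrite !mxE.
under eq_mx => i j do rewrite sum_pos_orth.
case: ifPn => [ab|/injectivePn[p [q pq zpq]]]; last first.
  by rewrite (determinant_alternate pq) ?mulr0// => j; rewrite !mxE zpq.
have -> : \matrix_(i, j) (n%:R * (a i == a j)%:R) = n%:R%:M :> 'M[F]_m.
  by apply/matrixP => i j; rewrite !mxE (inj_eq (injectiveP _ ab)) mulr_natr.
rewrite det_scalar natrM natrX mulrC [m`!%:R * _]mulrC; congr (_ * _ ^+ _).
rewrite big_imset /=; last by move=> i j _ _; exact: (injectiveP _ ab).
by apply: eq_bigl => i; rewrite inE.
Qed.

End WalkCount.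

(** * Bead patterns and closed walks *)

Lemma card_down_closed (k : nat) (P : pred 'I_k) :
  (forall i j : 'I_k, (i <= j)%N -> P j -> P i) -> forall i, P i = (i < #|P|)%N.
Proof.
have card_below (i : nat) : (i <= k)%N -> #|[pred j : 'I_k | (j < i)%N]| = i.
  by move=> ik; rewrite -sum1_card (big_ord_narrow ik) sum_nat_const card_ord muln1.
move=> Pdown i; apply/idP/idP => [Pi|].
  rewrite -[X in (X <= _)%N](card_below i.+1)//; apply/subset_leq_card/fintype.subsetP.
  by move=> j; rewrite !inE ltnS => /Pdown; exact.
apply: contraLR => Pi; rewrite -leqNgt -[X in (_ <= X)%N](card_below i (ltnW (ltn_ord i))).
apply/subset_leq_card/fintype.subsetP => j; rewrite !inE ltnNge => Pj.
by apply: contra Pi => /Pdown; exact.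
Qed.

Section Interlacing.
Variables (k N : nat) (a b : 'I_k -> 'I_N).
Hypotheses (a_incr : {homo a : i j / (i < j)%N}) (b_incr : {homo b : i j / (i < j)%N}).
Hypothesis a_neq_b : forall i j, a i != b j.

Let count_lt (c : 'I_k -> 'I_N) r := #|[pred i | (c i < r)%N]|.

Let count_ltP (c : 'I_k -> 'I_N) : {homo c : i j / (i < j)%N} ->
  forall r i, (c i < r)%N = (i < count_lt c r)%N.
Proof.
move=> c_incr r i; rewrite -(card_down_closed (P := [pred i | (c i < r)%N]))// => {}i j.
by rewrite leq_eqVlt => /predU1P[/val_inj ->//|/c_incr ij] /=; exact: ltn_trans.
Qed.

(** For the converse, the counts are compared just after [b i], at time [(b i).+1]; then [a_neq_b]
    makes the resulting inequality strict. *)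
Lemma forall_ltn_count : [forall i, (a i < b i)%N] =
  [forall r : 'I_N.+1, (#|[pred i | (b i < r)%N]| <= #|[pred i | (a i < r)%N]|)%N].
Proof.
apply/forallP/forallP => [ab r|ba i].
  by apply/subset_leq_card/fintype.subsetP => i; rewrite !inE; exact: ltn_trans.
have := ba (Ordinal (ltn_ord (b i) : (b i).+1 < N.+1)%N) => /=.
rewrite -/(count_lt a _) -/(count_lt b _) => /(leq_trans _) H.
have /H : (i < count_lt b (b i).+1)%N by rewrite -count_ltP.
by rewrite -count_ltP// ltnS leq_eqVlt (inj_eq val_inj) (negbTE (a_neq_b _ _)).
Qed.

Lemma forall_succ_ltn_count :
  [forall i : 'I_k, forall j : 'I_k, (j == i.+1 :> nat) ==> (b i < a j)%N] =
  [forall r : 'I_N.+1, (#|[pred i | (a i < r)%N]| <= #|[pred i | (b i < r)%N]|.+1)%N].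
Proof.
apply/forallP/forallP => [ba r|ab i].
  rewrite -/(count_lt a _) -/(count_lt b _) leqNgt; apply/negP => ltba.
  have ak : (count_lt a r <= k)%N by rewrite -[X in (_ <= X)%N]card_ord max_card.
  pose j := Ordinal (leq_trans ltba ak).
  pose i := Ordinal (leq_trans (ltnW ltba) ak).
  have aj : (a j < r)%N by rewrite count_ltP.
  have /forallP/(_ j)/implyP/(_ (eqxx _)) baij := ba i.
  by have := ltn_trans baij aj; rewrite count_ltP// ltnn.
apply/forallP => j; apply/implyP => /eqP ji.
have := ab (Ordinal (ltn_ord (a j) : (a j).+1 < N.+1)%N) => /=.
rewrite -/(count_lt a _) -/(count_lt b _) => /(leq_trans _) H.
have /H : (j < count_lt a (a j).+1)%N by rewrite -count_ltP.
by rewrite ji ltnS -count_ltP// ltnS leq_eqVlt (inj_eq val_inj) eq_sym (negbTE (a_neq_b _ _)).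
Qed.

End Interlacing.

Section Patterns.
Variables n k : nat.
Implicit Types (r : rel ('I_n * 'I_k)) (h : 'I_n).

(* The combinatorial type of an array is recorded by the relation [r], where
   [r (h, i) (h', i')] means that bead [i] of string [h] comes strictly before
   bead [i'] of string [h']. *)
Definition strings_sorted r :=
  [forall h, forall i : 'I_k, forall j : 'I_k, (i < j)%N ==> r (h, i) (h, j)].

(** With [trails], the two alternatives of [interlacing]. Weak inequalities are encoded as negated
    strict ones, so ties are treated as there. *)
Definition leads r h :=
  [forall i, ~~ r (ordS h, i) (h, i)] &&
  [forall i : 'I_k, forall j : 'I_k, (j == i.+1 :> nat) ==> r (ordS h, i) (h, j)].

Definition trails r h :=
  [forall i, r (ordS h, i) (h, i)] &&
  [forall i : 'I_k, forall j : 'I_k, (j == i.+1 :> nat) ==> ~~ r (ordS h, j) (h, i)].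

Definition bead_pattern l r :=
  [&& strings_sorted r, [forall h, leads r h || trails r h]
    & #|[set h | trails r h]| == l].

Lemma leads_trails r h : (0 < k)%N -> leads r h -> trails r h = false.
Proof.
move=> k0 /andP[/forallP/(_ (Ordinal k0)) L _]; apply/negP => /andP[/forallP/(_ (Ordinal k0))].
by rewrite (negbTE L).
Qed.

End Patterns.

(** * Legal words characterised by letter counts *)

Section Runs.
Variable n : nat.
Implicit Types (Y Z : {set 'I_n}) (w : seq 'I_n) (g h : 'I_n).

Lemma ordS_neq h : (1 < n)%N -> ordS h != h.
Proof.
move=> n1; apply/negP => /eqP /(congr1 val) /=.
have hn := ltn_ord h; have [hn'|hn'] := ltnP h.+1 n; first by rewrite modn_small//; lia.
have -> : h.+1 = n by lia.
by rewrite modnn; lia.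
Qed.

(** Balance of holes on string [h + 1]: the letter [h] removes one, the letter [h + 1] brings
    one. *)
Lemma hopE Y g Y' : (1 < n)%N -> hop Y g = Some Y' ->
  forall h, ((ordS h \in Y') + (g == h) = (ordS h \in Y) + (g == ordS h))%N.
Proof.
move=> n1; rewrite /hop; case: ifP => // /andP[gY]; rewrite !inE negb_and negbK.
rewrite eq_sym (negbTE (ordS_neq g n1)) /= => gNY [<-] h; rewrite !inE.
rewrite (inj_eq (can_inj (@ordSK n))) [h == g]eq_sym [ordS h == g]eq_sym.
have [<-|gh] := eqVneq g h; first by rewrite gY eq_sym (negbTE (ordS_neq g n1)).
by have [<-|] := eqVneq g (ordS h); rewrite ?(negbTE gNY) // addn0 addn0.
Qed.

Lemma hop_neq_None Y g : (1 < n)%N ->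
  hop Y g <> None <-> ordS g \in Y /\ g \notin Y.
Proof.
move=> n1; rewrite /hop !inE negb_and negbK eq_sym (negbTE (ordS_neq g n1)) /=.
by case: (ordS g \in Y); case: (g \notin Y); split=> // -[].
Qed.

(** By [hopE], the hole indicator of string [h + 1] after a prefix is its initial value plus the
    number of letters [h + 1] minus the number of letters [h]. A word is legal when this stays 0 or
    1 throughout. *)
Lemma runP Y Z w : (1 < n)%N ->
  run Y w = Some Z <->
  (forall r h, (r <= size w)%N ->
     (count_mem h (take r w) <= (ordS h \in Y) + count_mem (ordS h) (take r w)
        <= (count_mem h (take r w)).+1)%N) /\
  (forall h, ((ordS h \in Y) + count_mem (ordS h) w = count_mem h w + (ordS h \in Z))%N).
Proof.
move=> n1; elim: w Y => [|g w IH] Y /=.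
  split=> [[<-]|[_ YZ]].
    by split=> [r h _|h]; rewrite ?addn0//=; case: (_ \in _).
  congr Some; apply/setP => h; have := YZ (ord_pred h); rewrite ord_predK addn0 add0n.
  by do 2 case: (h \in _).
case E: (hop Y g) => [Y'|] /=; last first.
  split=> // -[H _]; exfalso; move: E; apply/(hop_neq_None Y g n1).
  (* The prefix of length 1 suffices: [h = g] puts a hole on string [ordS g], and [h = ord_pred g]
     leaves none on string [g]. *)
  have := H 1%N g isT; have := H 1%N (ord_pred g) isT.
  rewrite /= !take0 /= ord_predK eqxx !addn0.
  have -> : (g == ordS g) = false by apply/negbTE; rewrite eq_sym ordS_neq.
  have -> : (g == ord_pred g) = false.
    by apply/negbTE; have := ordS_neq (ord_pred g) n1; rewrite ord_predK.
  by case: (ordS g \in Y); case: (g \in Y).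
have hE := hopE n1 E; rewrite (IH Y'); split=> -[H1 H2]; split.
- case=> [h _|r h]; first by rewrite /= addn0; case: (_ \in _).
  by rewrite ltnS => /(H1 _ h) /=; have := hE h;
    case: (g == h); case: (g == ordS h); case: (ordS h \in Y); case: (ordS h \in Y') => /=; lia.
- by move=> h; have := H2 h; have := hE h;
    case: (g == h); case: (g == ordS h); case: (ordS h \in Y); case: (ordS h \in Y') => /=; case: (ordS h \in Z); lia.
- by move=> r h rw; have := H1 r.+1 h rw; have := hE h => /=;
    case: (g == h); case: (g == ordS h); case: (ordS h \in Y); case: (ordS h \in Y') => /=; lia.
- by move=> h; have := H2 h; have := hE h;
    case: (g == h); case: (g == ordS h); case: (ordS h \in Y); case: (ordS h \in Y') => /=; case: (ordS h \in Z); lia.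
Qed.

Lemma count_mem_ordS_const w c : (forall h, count_mem (ordS h) w = count_mem h w) ->
  size w = (n * c)%N -> forall h, count_mem h w = c.
Proof.
move=> wS sw h0; have n0 : (0 < n)%N := leq_ltn_trans (leq0n _) (ltn_ord h0).
have const h : count_mem h w = count_mem (Ordinal n0) w.
  have [x xn ->] : exists2 x : nat, (x < n)%N & h = iter x (@ordS n) (Ordinal n0).
    exists h => //; apply/val_inj => /=.
    suff H x : (x < n)%N -> val (iter x (@ordS n) (Ordinal n0)) = x by rewrite [RHS]H.
    by elim: x => //= x IH xn; rewrite IH 1?ltnW// modn_small.
  by elim: x {xn} => //= x IH; rewrite wS.
have : (\sum_(h : 'I_n) count_mem h w)%N = size w.
  elim: w {sw wS const} => [|g w IH] /=; first by rewrite big1.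
  by rewrite big_split /= IH (bigD1 g)//= eqxx big1 // => h /negbTE; rewrite eq_sym => ->.
under eq_bigr => h _ do rewrite const.
rewrite sum_nat_const card_ord sw const => /eqP.
by rewrite eqn_pmul2l// => /eqP.
Qed.

End Runs.

(** * Permutations as words in the strings *)

Section Words.
Variables n k : nat.
Implicit Types (s : 'S_(n * k)) (h g : 'I_n).

Definition mxvec_split (x : 'I_(n * k)) : 'I_n * 'I_k :=
  enum_val (cast_ord (esym (mxvec_cast n k)) x).

Lemma mxvec_splitK x : mxvec_index (mxvec_split x).1 (mxvec_split x).2 = x.
Proof.
rewrite /mxvec_index /mxvec_split -surjective_pairing enum_valK.
by apply/val_inj.
Qed.

Lemma mxvec_indexK h i : mxvec_split (mxvec_index h i) = (h, i).
Proof. by rewrite /mxvec_split /mxvec_index cast_ordK enum_rankK. Qed.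

Definition position_rel (d : Order.disp_t) (T : porderType d) (f : 'I_(n * k) -> T) :
    rel ('I_n * 'I_k) :=
  fun p q => (f (mxvec_index p.1 p.2) < f (mxvec_index q.1 q.2))%O.

(** Here [s] sends an entry of the array to its rank in time, so letter [x] is the string carrying
    the bead of rank [x]; the number of the bead on its string is forgotten. *)
Definition word s : (n * k).-tuple 'I_n :=
  [tuple (mxvec_split ((s^-1)%g x)).1 | x < n * k].

Local Notation srel s := (position_rel (fun x => s x : nat)).

Lemma nth_word s h i g : nth g (word s) (s (mxvec_index h i)) = h.
Proof. by rewrite -tnth_nth tnth_mktuple permK mxvec_indexK. Qed.

Lemma count_mem_word s h r : (r <= n * k)%N ->
  count_mem h (take r (word s)) = #|[pred i | (s (mxvec_index h i) < r)%N]|.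
Proof.
move=> rnk.
have -> : count_mem h (take r (word s)) =
    \sum_(x < n * k | (x < r)%N) (tnth (word s) x == h).
  rewrite (big_ord_narrow rnk) /= -sum1_count.
  have sr : size (take r (word s)) = r by rewrite size_takel// size_tuple.
  rewrite (big_nth h) sr big_mkord big_mkcond /=; apply: eq_bigr => x _.
  by rewrite nth_take// (tnth_nth h); case: (_ == _).
rewrite -sum1_card (reindex_inj (@perm_inj _ s)) /= big_mkcond /=.
rewrite (reindex (fun p : 'I_n * 'I_k => mxvec_index p.1 p.2)) /=; last first.
  exists mxvec_split => [[h' i] _|x _]; first by rewrite mxvec_indexK.
  exact: mxvec_splitK.
rewrite -(pair_big xpredT xpredT (fun h' i =>
  if (s (mxvec_index h' i) < r)%N then nat_of_bool
    (tnth (word s) (s (mxvec_index h' i)) == h) else 0%N)) /=.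
rewrite (bigD1 h)//= [X in (_ + X)%N]big1 ?addn0.
  rewrite [RHS]big_mkcond /=; apply: eq_bigr => i _.
  by rewrite (tnth_nth h) nth_word eqxx.
move=> h' h'h; apply: big1 => i _.
by rewrite (tnth_nth h) nth_word (negbTE h'h) if_same.
Qed.

Lemma strings_sortedP s : reflect
  (forall h, {homo (fun i => s (mxvec_index h i)) : i j / (i < j)%N})
  (strings_sorted (srel s)).
Proof.
apply: (iffP forallP) => [H h i j ij|H h].
  by have /forallP/(_ i)/forallP/(_ j)/implyP/(_ ij) := H h; rewrite /position_rel ltEnat.
by apply/forallP => i; apply/forallP => j; apply/implyP => ij;
  rewrite /position_rel ltEnat; exact: H.
Qed.

Lemma count_mem_word_bead s h i : strings_sorted (srel s) ->
  count_mem h (take (s (mxvec_index h i)) (word s)) = i.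
Proof.
move=> /strings_sortedP sS; rewrite (count_mem_word _ _ (ltnW (ltn_ord _))).
transitivity #|[pred j : 'I_k | (j < i)%N]|; last first.
  by rewrite -sum1_card (big_ord_narrow (ltnW (ltn_ord i))) sum_nat_const card_ord muln1.
apply: eq_card => j; rewrite !inE; case: (ltngtP j i) => [/(sS h) //|/(sS h)|/val_inj ->].
  by move/ltnW; rewrite leqNgt => /negbTE.
by rewrite ltnn.
Qed.

Lemma count_mem_word_all s h : count_mem h (word s) = k.
Proof.
rewrite -[X in count_mem _ X](take_size (word s)) size_tuple count_mem_word//.
by rewrite (eq_card (B := 'I_k)) ?card_ord// => i; rewrite !inE ltn_ord.
Qed.

Lemma word_inj s s' : strings_sorted (srel s) -> strings_sorted (srel s') ->
  word s = word s' -> s = s'.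
Proof.
move=> sS sS' ss'; apply/permP => x; rewrite -(mxvec_splitK x).
case: (mxvec_split x) => h i /=; set y := s _.
have [i' yi'] : exists i', y = s' (mxvec_index h i').
  exists (mxvec_split ((s'^-1)%g y)).2.
  have <- : (mxvec_split ((s'^-1)%g y)).1 = h; last by rewrite mxvec_splitK permKV.
  by have := nth_word s h i h; rewrite ss' -/y -tnth_nth tnth_mktuple.
rewrite yi'; congr (s' (mxvec_index h _)); apply/val_inj => /=.
by rewrite -(count_mem_word_bead h i' sS') -yi' -ss' count_mem_word_bead.
Qed.

(** The bead read at position [x] must bear the number [c x] of earlier occurrences of its letter.
    The resulting map [rho] from ranks to entries is injective, and [s] is its inverse. *)
Lemma word_surj (t : (n * k).-tuple 'I_n) : (forall h, count_mem h t = k) ->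
  exists2 s : 'S_(n * k), strings_sorted (srel s) & word s = t.
Proof.
move=> tk; pose c (x : 'I_(n * k)) := count_mem (tnth t x) (take x t).
have take_succ (x : 'I_(n * k)) h :
    count_mem h (take x.+1 t) = (count_mem h (take x t) + (tnth t x == h))%N.
  rewrite (take_nth h) ?size_tuple// -cats1 count_cat /= addn0.
  by rewrite (tnth_nth h).
have count_take_mono x y h : (x <= y)%N ->
    (count_mem h (take x t) <= count_mem h (take y t))%N.
  move=> xy; rewrite -(subnKC xy) takeD count_cat; exact: leq_addr.
have ck x : (c x < k)%N.
  rewrite -(tk (tnth t x)); apply: leq_trans (_ : _ <= count_mem (tnth t x) (take x.+1 t))%N _.
    by rewrite take_succ eqxx addn1.
  by rewrite -[X in (_ <= count_mem _ X)%N](cat_take_drop x.+1 t) count_cat leq_addr.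
pose rho x := mxvec_index (tnth t x) (Ordinal (ck x)).
have c_lt x y : tnth t x = tnth t y -> (x < y)%N -> (c x < c y)%N.
  move=> txy xy; apply: leq_trans (count_take_mono x.+1 y (tnth t y) xy).
  by rewrite take_succ /c txy eqxx addn1.
have rho_inj : injective rho.
  move=> x y /(congr1 mxvec_split); rewrite /rho !mxvec_indexK => -[txy cxy].
  apply/val_inj; case: (ltngtP x y) => // [/(c_lt _ _ txy)|/(c_lt _ _ (esym txy))];
  by rewrite cxy ltnn.
pose s := (perm rho_inj)^-1%g.
have sE h i : tnth t (s (mxvec_index h i)) = h /\ c (s (mxvec_index h i)) = i.
  have : rho (s (mxvec_index h i)) = mxvec_index h i by rewrite -(permE rho_inj) permKV.
  move=> /(congr1 mxvec_split); rewrite /rho !mxvec_indexK => -[th ci].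
  by split=> //; rewrite -[in RHS]ci.
exists s.
  apply/strings_sortedP => h i j ij; rewrite ltnNge; apply/negP.
  have [ti ci] := sE h i; have [tj cj] := sE h j.
  rewrite leq_eqVlt => /predU1P[/val_inj e|]; first by move: ij; rewrite -ci -cj e ltnn.
  move=> /(fun lt tt => c_lt _ _ tt lt); rewrite ti tj ci cj.
  by move=> /(_ erefl); rewrite ltnNge ltnW.
apply: eq_from_tnth => x; rewrite tnth_mktuple /s invgK permE.
by rewrite /rho mxvec_indexK.
Qed.

End Words.

(** * Bijection between bead patterns and closed words *)

Section WalkPatterns.
Variables n k : nat.
Hypotheses (n_gt0 : (0 < n)%N) (k_gt0 : (0 < k)%N).
Implicit Types (s : 'S_(n * k)) (h g : 'I_n) (Y : {set 'I_n}).

Local Notation srel s := (position_rel (fun x => s x : nat)).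

Let count_lt s h r := #|[pred i : 'I_k | (s (mxvec_index h i) < r)%N]|.

Let bead_neq s h i j : (1 < n)%N -> s (mxvec_index h i) != s (mxvec_index (ordS h) j).
Proof.
move=> n1; rewrite (inj_eq (@perm_inj _ s)); apply/eqP => /(congr1 (@mxvec_split n k)).
by rewrite !mxvec_indexK => -[/eqP]; rewrite eq_sym (negbTE (ordS_neq h n1)).
Qed.

Let leadsE s h : (1 < n)%N -> strings_sorted (srel s) ->
  leads (srel s) h = [forall r : 'I_(n * k).+1,
    (count_lt s (ordS h) r <= count_lt s h r <= (count_lt s (ordS h) r).+1)%N].
Proof.
move=> n1 /strings_sortedP sS.
have ab i j := bead_neq s h i j n1.
transitivity ([forall r : 'I_(n * k).+1, (count_lt s (ordS h) r <= count_lt s h r)%N] &&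
  [forall r : 'I_(n * k).+1, (count_lt s h r <= (count_lt s (ordS h) r).+1)%N]).
  rewrite -(forall_ltn_count (sS h) (sS (ordS h)) ab).
  rewrite -(forall_succ_ltn_count (sS h) (sS (ordS h)) ab); congr (_ && _).
  apply: eq_forallb => i; rewrite /position_rel ltEnat /= -leqNgt leq_eqVlt.
  by rewrite (inj_eq val_inj) (negbTE (ab _ _)).
apply/andP/forallP => [[/forallP H1 /forallP H2] r|H]; first by rewrite H1 H2.
by split; apply/forallP => r; case/andP: (H r).
Qed.

Let trailsE s h : (1 < n)%N -> strings_sorted (srel s) ->
  trails (srel s) h = [forall r : 'I_(n * k).+1,
    (count_lt s h r <= count_lt s (ordS h) r <= (count_lt s h r).+1)%N].
Proof.
move=> n1 /strings_sortedP sS.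
have ba i j : s (mxvec_index (ordS h) i) != s (mxvec_index h j).
  by rewrite eq_sym bead_neq.
transitivity ([forall r : 'I_(n * k).+1, (count_lt s h r <= count_lt s (ordS h) r)%N] &&
  [forall r : 'I_(n * k).+1, (count_lt s (ordS h) r <= (count_lt s h r).+1)%N]).
  rewrite -(forall_ltn_count (sS (ordS h)) (sS h) ba).
  rewrite -(forall_succ_ltn_count (sS (ordS h)) (sS h) ba); congr (_ && _).
  apply: eq_forallb => i; apply: eq_forallb => j; congr (_ ==> _).
  rewrite /position_rel ltEnat /= -leqNgt leq_eqVlt.
  by rewrite (inj_eq val_inj) eq_sym (negbTE (ba _ _)).
apply/andP/forallP => [[/forallP H1 /forallP H2] r|H]; first by rewrite H1 H2.
by split; apply/forallP => r; case/andP: (H r).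
Qed.

(** A hole initially on string [h + 1] has to leave, by a bead on [h], before another arrives, by a
    bead on [h + 1]; without an initial hole the order is reversed. The letters then alternate, as
    in [leads] and [trails]. *)
Lemma run_word Y s : strings_sorted (srel s) ->
  run Y (word s) = Some Y <->
  forall h, if ordS h \in Y then leads (srel s) h else trails (srel s) h.
Proof.
move=> sS; have [n1|n1] := ltnP 1 n.
  rewrite runP//; split=> [[H _] h|H].
    have {}H (r : 'I_(n * k).+1) : (count_lt s h r <=
        (ordS h \in Y) + count_lt s (ordS h) r <= (count_lt s h r).+1)%N.
      have rnk : (r <= n * k)%N by rewrite -ltnS.
      by have := H r h; rewrite size_tuple !count_mem_word//; exact.
    by case: ifPn => [hY|/negbTE hY]; rewrite ?leadsE ?trailsE//; apply/forallP => r;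
      have := H r; rewrite hY /=; lia.
  split=> [r h|h]; last by rewrite !count_mem_word_all addnC.
  rewrite size_tuple => rnk; rewrite !count_mem_word// -!/(count_lt _ _ _).
  by have := H h; case: ifP => hY; rewrite ?leadsE ?trailsE//;
    move=> /forallP/(_ (Ordinal (rnk : (r < (n * k).+1)%N))) /=; lia.
(* A single string is its own neighbour: it always leads, and never trails because k > 0.
   Correspondingly a hole stays put forever, and without a hole the first letter is illegal. *)
have nE : n = 1%N by apply/anti_leq; rewrite n1.
have ordSE h : ordS h = h by move: h; rewrite nE => h; rewrite [h]ord1; apply/val_inj.
have eq1 h g : h = g by apply/val_inj => /=; have := ltn_ord h; have := ltn_ord g; lia.
have L h : leads (srel s) h.
  rewrite /leads ordSE; apply/andP; split.
    by apply/forallP => i; rewrite /position_rel /= ltxx.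
  apply/forallP => i; apply/forallP => j; apply/implyP => /eqP ij.
  rewrite /position_rel ltEnat /=; move/strings_sortedP: sS; apply.
  by rewrite ij.
pose h0 := Ordinal n_gt0.
have runE w : h0 \in Y -> run Y w = Some Y.
  move=> hY; elim: w => //= g w IH; rewrite /hop ordSE (eq1 g h0) hY !inE eqxx /=.
  by rewrite finset.setD1K.
split=> [R h|/(_ h0)]; rewrite ordSE; last first.
  case: ifP => [/runE ->//|_ /andP[/forallP/(_ (Ordinal k_gt0))]].
  by rewrite /position_rel ordSE ltxx.
case: ifPn => // hY; move: R; case E: (tval (word s)) => [|g w] /=.
  by have := size_tuple (word s); rewrite E /= => /esym/eqP; rewrite muln_eq0; lia.
by rewrite /hop ordSE (eq1 g h) (negbTE hY).
Qed.

Lemma closed_run_balanced Y (t : (n * k).-tuple 'I_n) h :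
  run Y t = Some Y -> count_mem h t = k.
Proof.
move=> R; apply: count_mem_ordS_const; last exact: size_tuple.
move=> {}h; have [n1|n1] := ltnP 1 n.
  move/(runP Y Y t n1): R => [_ /(_ h)]; rewrite addnC => /addIn; exact.
by congr (count_mem _ t); apply/val_inj; have := ltn_ord h; have := ltn_ord (ordS h) => /=; lia.
Qed.

Theorem card_bead_pattern l : (l <= n)%N ->
  #|[set s : 'S_(n * k) | bead_pattern l (srel s)]| =
  \sum_(Y : {set 'I_n} | #|Y| == n - l) walks (n * k) Y Y.
Proof.
move=> ln.
pose YW := [set p : {set 'I_n} * (n * k).-tuple 'I_n |
  (#|p.1| == n - l) && (run p.1 p.2 == Some p.1)].
transitivity #|YW|; last first.
  rewrite -sum1_card (eq_bigl (fun p : {set 'I_n} * (n * k).-tuple 'I_n =>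
    (#|p.1| == n - l) && (run p.1 p.2 == Some p.1))); last by move=> p; rewrite inE.
  rewrite -(pair_big_dep (fun Y => #|Y| == n - l)
    (fun Y (t : (n * k).-tuple 'I_n) => run Y t == Some Y) (fun _ _ => 1%N)) /=.
  by apply: eq_bigr => Y _; rewrite sum1_card; apply: eq_card => t; rewrite !inE.
(* The initial hole set is forced by the pattern, so [s] alone determines the pair of hole set and
   word. *)
pose Yof s := [set g | leads (srel s) (ord_pred g)].
have YofE s h : (ordS h \in Yof s) = leads (srel s) h by rewrite inE ordSK.
have card_Yof s : [forall h, leads (srel s) h || trails (srel s) h] ->
    #|Yof s| = (n - #|[set h | trails (srel s) h]|)%N.
  move=> /forallP H; rewrite -[X in (X - _)%N]card_ord -(cardsC [set h | trails (srel s) h]) addKn.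
  transitivity #|[set h | leads (srel s) h]|.
    by rewrite -[RHS](card_preimset _ (can_inj (@ord_predK n))); apply: eq_card => g; rewrite !inE.
  apply: eq_card => h; rewrite !inE; have := H h.
  by case L : (leads _ _); rewrite ?(leads_trails k_gt0 L)// => /= ->.
rewrite -(card_in_imset (f := fun s => (Yof s, word s))); last first.
  move=> s s'; rewrite !inE => /and3P[sS _ _] /and3P[sS' _ _].
  by move=> /(congr1 snd) /=; exact: word_inj.
apply: eq_card => -[Y t]; rewrite inE /=; apply/imsetP/andP => [[s]|[/eqP cY /eqP R]].
  rewrite inE => /and3P[sS LT /eqP sl] [-> ->]; split.
    by rewrite card_Yof// sl.
  apply/eqP/run_word => // h; rewrite YofE; case: ifPn => // /negbTE L.
  by have /forallP/(_ h) := LT; rewrite L.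
have [s sS st] := word_surj (fun h => closed_run_balanced h R).
move: R; rewrite -st => /(run_word _ sS) H.
have YE : Y = Yof s.
  apply/setP => g; have := H (ord_pred g); rewrite ord_predK inE.
  case: ifP => _ Hg; first by rewrite Hg.
  by case L : (leads _ _) => //; rewrite (leads_trails k_gt0 L) in Hg.
have LT : [forall h, leads (srel s) h || trails (srel s) h].
  by apply/forallP => h; have := H h; case: ifP => _ ->; rewrite ?orbT.
exists s; last by rewrite YE.
rewrite inE /bead_pattern sS LT /=; move: cY; rewrite YE card_Yof// => e.
have : (#|[set h | trails (srel s) h]| <= n)%N.
  by rewrite -[X in (_ <= X)%N]card_ord max_card.
move: e ln; move: #|_| => c e ln cn; apply/eqP.
by rewrite -(subKn cn) e subKn.
Qed.

End WalkPatterns.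

(** * The occupation number of an array *)

Section CyclicDelay.
Local Open Scope ring_scope.
Variable R : realType.
Implicit Types a x u v : R.

(** The time needed to go forward from [a] to [x] on the circle of unit length. *)
Definition delay a x : R := if a <= x then x - a else x - a + 1.

Lemma mod1_add a u : 0 <= a < 1 -> 0 <= u < 1 ->
  mod1 (a + u) = if a + u < 1 then a + u else a + u - 1.
Proof.
move=> a01 u01; rewrite /mod1; case: ltP => au.
  by rewrite (@floor_def _ _ 0) ?subr0//; apply/andP; split; lra.
by rewrite (@floor_def _ _ 1) //; apply/andP; split; lra.
Qed.

Lemma delay_range a x : 0 <= a < 1 -> 0 <= x < 1 -> 0 <= delay a x < 1.
Proof.
move=> a01 x01; rewrite /delay.
by case: ifPn; rewrite -?ltNge => ax; apply/andP; split; lra.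
Qed.

Lemma mod1_delay a x : 0 <= a < 1 -> 0 <= x < 1 -> mod1 (a + delay a x) = x.
Proof.
move=> a01 x01; rewrite mod1_add ?delay_range// /delay.
by have [ax|ax] := leP a x; case: ltP => H; lra.
Qed.

Lemma delay_mod1 a v : 0 <= a < 1 -> 0 <= v < 1 -> delay a (mod1 (a + v)) = v.
Proof.
move=> a01 v01; rewrite mod1_add// /delay.
by have [av|av] := ltP; case: leP => H; lra.
Qed.

Lemma delay_lt a x y : 0 <= a < 1 -> 0 <= x < 1 -> 0 <= y < 1 ->
  (delay a x < delay a y) =
  if a <= x then (y < a) || (x < y) else (x < y) && (y < a).
Proof.
move=> a01 x01 y01; rewrite /delay.
have [ax|ax] := leP a x; have [ay|ay] := leP a y => /=.
- by apply/idP/idP => H; lra.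
- by apply/idP; lra.
- by rewrite andbF; apply/negbTE; rewrite -leNgt; lra.
- by rewrite andbT; apply/idP/idP => H; lra.
Qed.

End CyclicDelay.

Section Occupation.
Local Open Scope ring_scope.
Variables (R : realType) (n k : nat) (t : 'M[R]_(n, k)).
Hypotheses (k_gt0 : (0 < k)%N) (tcfg : bead_config t).
Implicit Types (s : R) (h : 'I_n).

Let t01 h i : 0 <= t h i < 1. Proof. by case: tcfg. Qed.
Let t_incr h : {homo (fun i => t h i) : i j / (i < j)%N >-> i < j}.
Proof. by move=> i j; case: tcfg => _ + _; exact. Qed.

Definition array_rel : rel ('I_n * 'I_k) := fun p q => t p.1 p.2 < t q.1 q.2.

(** The minimal delay [u] is absorbed by the quantifier over [j]: seen from bead [i], time [s] comes
    before every bead of the next string. *)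
Let occupiedP s h : 0 <= s < 1 ->
  occupied t s (ordS h) <->
  exists i, forall j, delay (t h i) s < delay (t h i) (t (ordS h) j).
Proof.
move=> s01; split=> [[h' [i [u [v [/(can_inj (@ordSK n)) <- [u01 [j0 j0u] umin] vu ->]]]]]|[i ij]].
  exists i => j; rewrite delay_mod1//; last by lra.
  apply: (@lt_le_trans _ _ u); first by case/andP: vu.
  by apply: umin; [exact: delay_range|exists j; rewrite mod1_delay].
pose d j := delay (t h i) (t (ordS h) j).
have [j _ dj] := @arg_minP _ _ _ (Ordinal k_gt0) xpredT d isT.
exists h, i, (d j), (delay (t h i) s); split => //.
- split; [exact: delay_range|by exists j; rewrite mod1_delay|].
  move=> v v01 [j' j'v]; rewrite -(delay_mod1 (t01 h i) v01) -j'v.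
  exact: dj.
- by rewrite ij andbT; case/andP: (delay_range (t01 h i) s01).
- by rewrite mod1_delay.
Qed.

(* The indicator of the occupation of [ordS h] is the difference of the numbers of
   beads of [h] and [ordS h] before time [s], up to the constant [trails _ h]: these
   differences telescope around the cylinder. *)
Let c h s := #|[pred i | t h i <= s]|.

Let cP h s i : (t h i <= s) = (i < c h s)%N.
Proof.
rewrite /c -(card_down_closed (P := [pred i | t h i <= s]))// => {}i j.
rewrite leq_eqVlt => /predU1P[/val_inj -> //|/(t_incr h) ij] /=.
by move=> js; apply: le_trans js; exact: ltW.
Qed.

Let cPn h s i : (s < t h i) = (c h s <= i)%N.
Proof. by rewrite ltNge cP -leqNgt. Qed.

Let c_le h s : (c h s <= k)%N.
Proof. by rewrite -[X in (_ <= X)%N]card_ord max_card. Qed.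

Lemma bead_config_leads_or_trails h : leads array_rel h || trails array_rel h.
Proof.
case: tcfg => _ _ /(_ h)[[H1 H2]|[H1 H2]]; apply/orP; [left|right]; apply/andP; split.
- by apply/forallP => i; rewrite /array_rel -leNgt.
- by apply/forallP => i; apply/forallP => j; apply/implyP => /eqP; exact: H2.
- by apply/forallP => i; rewrite /array_rel.
- apply/forallP => i; apply/forallP => j; apply/implyP => /eqP.
  by rewrite /array_rel -leNgt; exact: H2.
Qed.

Let occupied_count s h : 0 <= s < 1 ->
  (`[< occupied t s (ordS h) >] + c (ordS h) s = c h s + trails array_rel h)%N.
Proof.
move=> s01; have := bead_config_leads_or_trails h; have [L _|_ /= T] := boolP (leads _ _).
  rewrite (leads_trails k_gt0 L) addn0.
  case/andP: L => /forallP L1 /forallP L2.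
  have {}L1 i : t h i <= t (ordS h) i by have := L1 i; rewrite /array_rel -leNgt.
  have {}L2 (i j : 'I_k) : j = i.+1 :> nat -> t (ordS h) i < t h j.
    by move/eqP => ij; have /forallP/(_ j)/implyP := L2 i; exact.
  have BA : (c (ordS h) s <= c h s)%N.
    rewrite leqNgt; apply/negP => lt.
    pose i := Ordinal (leq_trans lt (c_le _ _)).
    have : t (ordS h) i <= s by rewrite cP.
    by move/(le_trans (L1 i)); rewrite cP /= ltnn.
  have AB : (c h s <= (c (ordS h) s).+1)%N.
    rewrite leqNgt; apply/negP => lt.
    pose j := Ordinal (leq_trans lt (c_le _ _)).
    pose i := Ordinal (leq_trans (ltnW lt) (c_le _ _)).
    have : t h j <= s by rewrite cP.
    by move/(le_trans (ltW (L2 i j erefl))); rewrite cP /= ltnn.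
  have [AeqB|AneB] := eqVneq (c h s) (c (ordS h) s).
    (* Whatever bead [i] is tried, bead [i] of the next string is met no later than time [s]. *)
    rewrite AeqB (_ : `[< _ >] = false) //; apply/asboolPn => /(occupiedP _ s01)[i ij].
    have := ij i; rewrite delay_lt//; have := L1 i; case: ifP.
      by rewrite cP AeqB -cP => ?; lra.
    by move=> ? ?; case/andP; lra.
  have AE : c h s = (c (ordS h) s).+1 by lia.
  rewrite AE (_ : `[< _ >] = true) //; apply/asboolP/(occupiedP _ s01).
  (* This index is that of the last bead of string [h] up to time [s], whose successor on the next
     string has not come yet. *)
  have ik : (c (ordS h) s < k)%N by rewrite -AE c_le.
  exists (Ordinal ik) => j; rewrite delay_lt// cP AE ltnS leqnn.
  rewrite [s < _]cPn; case: (leqP (c (ordS h) s) j) => jB; rewrite ?orbT// orbF.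
  have jk : (j.+1 < k)%N := leq_ltn_trans jB ik.
  apply: lt_le_trans (L2 j (Ordinal jk) erefl) _.
  have := jB; rewrite leq_eqVlt => /predU1P[jE|lt].
    by rewrite le_eqVlt; apply/orP; left; apply/eqP; congr (t h _); apply/val_inj.
  by apply/ltW/t_incr.
rewrite T.
case/andP: T => /forallP T1 /forallP T2.
have {}T2 (i j : 'I_k) : j = i.+1 :> nat -> t h i <= t (ordS h) j.
  by move/eqP => ij; have /forallP/(_ j)/implyP/(_ ij) := T2 i; rewrite /array_rel -leNgt.
have AB : (c h s <= c (ordS h) s)%N.
  rewrite leqNgt; apply/negP => lt.
  pose i := Ordinal (leq_trans lt (c_le _ _)).
  have : t h i <= s by rewrite cP.
  by move/(le_trans (ltW (T1 i))); rewrite cP /= ltnn.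
have BA : (c (ordS h) s <= (c h s).+1)%N.
  rewrite leqNgt; apply/negP => lt.
  pose j := Ordinal (leq_trans lt (c_le _ _)).
  pose i := Ordinal (leq_trans (ltnW lt) (c_le _ _)).
  have : t (ordS h) j <= s by rewrite cP.
  by move/(le_trans (T2 i j erefl)); rewrite cP /= ltnn.
have [AeqB|AneB] := eqVneq (c h s) (c (ordS h) s); last first.
  have BE : c (ordS h) s = (c h s).+1 by lia.
  rewrite BE (_ : `[< _ >] = false) ?addn1//; apply/asboolPn => /(occupiedP _ s01)[i ij].
  (* The obstruction is bead [i + 1] of the next string if bead [i] precedes [s], and otherwise,
     after wrapping around, its first bead. *)
  have [iA|iA] := ltnP i (c h s).
    have jk : (i.+1 < k)%N by apply: leq_trans (c_le (ordS h) s); rewrite BE.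
    have := ij (Ordinal jk); rewrite delay_lt// cP iA.
    rewrite [s < _]cPn BE /= ltnNge iA orbF.
    by rewrite ltNge T2.
  have := ij (Ordinal k_gt0); rewrite delay_lt// cP ltnNge iA /=.
  by rewrite cPn BE.
rewrite -AeqB addn1 (_ : `[< _ >] = true) ?add1n//; apply/asboolP/(occupiedP _ s01).
(* If string [h] has had no bead up to time [s], the occupation stems from its last bead in the
   previous turn, numbered [k.-1]. *)
case A0 : (c h s) => [|A].
  have lastk : (k.-1 < k)%N by rewrite prednK.
  exists (Ordinal lastk) => j; rewrite delay_lt// cP A0 ltn0 cPn -AeqB A0 /=.
  apply: le_lt_trans (T1 (Ordinal lastk)).
  have : (j <= k.-1)%N by rewrite -ltnS prednK.
  rewrite leq_eqVlt => /predU1P[jE|lt].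
    by rewrite le_eqVlt; apply/orP; left; apply/eqP; congr (t _ _); apply/val_inj.
  by apply/ltW/t_incr.
have Ak : (A < k)%N by rewrite -A0 c_le.
exists (Ordinal Ak) => j; rewrite delay_lt// cP A0 ltnS leqnn.
rewrite [s < _]cPn -AeqB A0; case: (leqP A.+1 j) => jA; rewrite ?orbT// orbF.
apply: le_lt_trans (T1 (Ordinal Ak)); move: jA; rewrite ltnS.
rewrite leq_eqVlt => /predU1P[jE|lt].
  by rewrite le_eqVlt; apply/orP; left; apply/eqP; congr (t _ _); apply/val_inj.
by apply/ltW/t_incr.
Qed.

Lemma card_occupation_set s : 0 <= s < 1 ->
  #|occupation_set t s| = #|[set h | trails array_rel h]%SET|.
Proof.
move=> s01; apply: (@addIn (\sum_h c h s)%N).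
have -> : #|occupation_set t s| = (\sum_h `[< occupied t s (ordS h) >])%N.
  rewrite -sum1_card big_mkcond /= (reindex_inj (can_inj (@ordSK n))) /=.
  by apply: eq_bigr => h _; rewrite inE; case: ifP.
have -> : #|[set h | trails array_rel h]%SET| = (\sum_h trails array_rel h)%N.
  by rewrite -sum1_card big_mkcond /=; apply: eq_bigr => h _; rewrite inE; case: ifP.
rewrite [X in (_ + X)%N = _](reindex_inj (can_inj (@ordSK n))) -!big_split /=.
by apply: eq_bigr => h _; rewrite occupied_count// addnC.
Qed.

End Occupation.

Lemma nkl_configP (R : realType) (n k l : nat) (t : 'M[R]_(n, k)) :
  (0 < k)%N ->
  nkl_config l t <->
  (forall h i, 0 <= t h i < 1)%R /\ bead_pattern l (array_rel t).
Proof.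
move=> k0.
have s0 : (0 <= (0 : R) < 1)%R by apply/andP; split.
split=> [[cfg occ]|[t01 /and3P[/forallP S /forallP LT /eqP cl]]].
  split; first by case: cfg.
  apply/and3P; split.
  - apply/forallP => h; apply/forallP => i; apply/forallP => j; apply/implyP.
    by case: cfg => _ + _; exact.
  - by apply/forallP => h; exact: bead_config_leads_or_trails.
  - by rewrite -(card_occupation_set k0 cfg s0) occ.
have cfg : bead_config t.
  split=> // [h i j|h].
    by have /forallP/(_ i)/forallP/(_ j)/implyP := S h; exact.
  case/orP: (LT h) => /andP[/forallP H1 /forallP H2]; [left|right]; split.
  - by move=> i; have := H1 i; rewrite /array_rel -leNgt.
  - by move=> i j /eqP; have /forallP/(_ j)/implyP := H2 i; exact.
  - by move=> i; exact: H1.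
  - move=> i j /eqP ij; have /forallP/(_ j)/implyP/(_ ij) := H2 i.
    by rewrite /array_rel -leNgt.
by split=> // s s01; rewrite card_occupation_set.
Qed.

(** * Volumes of order types *)

Local Open Scope classical_set_scope.
Local Open Scope ring_scope.

Lemma measure_finType_bigcup d (T : measurableType d) (R : realType)
    (mu : {measure set T -> \bar R}) (I : finType) (P : pred I) (F : I -> set T) :
  (forall i, P i -> measurable (F i)) -> trivIset [set i | P i] F ->
  mu (\bigcup_(i in [set i | P i]) F i) = (\sum_(i | P i) mu (F i))%E.
Proof.
move=> mF tF; rewrite measure_fin_bigcup//; last exact: finite_finset.
rewrite (fsbigE [seq i <- enum I | P i]).
- rewrite big_filter_cond big_enum_cond /=; apply: eq_bigl => i.
  by case Pi : (P i); rewrite // andbC mem_set.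
- by rewrite filter_uniq// enum_uniq.
- by move=> i /=; rewrite mem_filter => /andP[].
- by move=> i /= Pi; rewrite mem_filter Pi mem_enum.
Qed.

Section OrderTypes.
Variables (R : realType) (N : nat).
Local Open Scope ring_scope.
Local Notation RN := (N.-tuple (measurableTypeR R)).
Local Notation mu := (@lebesgue_tuple R N).

(** All strict comparisons are recorded, so arrays with ties have types of their own, distinct from
    those of permutations. *)
Definition order_type (d : Order.disp_t) (T : porderType d) (f : 'I_N -> T) :
    {ffun 'I_N * 'I_N -> bool} := [ffun p => (f p.1 < f p.2)%O].

Definition cube : set RN := [set x | forall i, 0 <= tnth x i < 1].

Lemma measurable_cube : measurable cube.
Proof.
rewrite (_ : cube = \bigcap_(i in [set: 'I_N]) (@tnth _ _ ^~ i @^-1` `[0, 1[%classic)).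
  apply: fin_bigcap_measurable => [|i _]; first exact: finite_finset.
  by rewrite -[X in measurable X]setTI; apply: measurable_tnth => //; exact: measurable_itv.
by apply/seteqP; split => [x Bx i _|x Bx i]; [rewrite /= in_itv; exact: Bx|
  have := Bx i I; rewrite /= in_itv].
Qed.

Lemma lebesgue_tuple_cube : mu cube = 1%E.
Proof.
transitivity (mu [set t | forall i, `[0, 1[%classic (tnth t i)]).
  by congr (mu _); apply/seteqP; split => x /= H i; have := H i; rewrite in_itv.
rewrite (@lebesgue_tuple_box _ _ (fun=> `[0, 1[%classic)); last by move=> i; exact: measurable_itv.
by rewrite big1// => i _; rewrite lebesgue_measure_itv /= lte_fin ltr01 oppr0 adde0.
Qed.

Definition order_cell (c : {ffun 'I_N * 'I_N -> bool}) : set RN :=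
  cube `&` [set x | order_type (tnth x : 'I_N -> R) = c].

Lemma measurable_order_cell c : measurable (order_cell c).
Proof.
apply: measurableI; first exact: measurable_cube.
rewrite (_ : [set _ | _] = \bigcap_(p in [set: 'I_N * 'I_N])
    ((fun x : RN => (tnth x p.1 : R) < tnth x p.2) @^-1` [set c p])); last first.
  apply/seteqP; split => [x /= <- p _|x /= H]; first by rewrite /= ffunE.
  by apply/ffunP => p; rewrite ffunE; exact: H.
apply: fin_bigcap_measurable => [|p _]; first exact: finite_finset.
rewrite -[X in measurable X]setTI; apply: measurable_fun_ltr => //;
exact: measurable_tnth.
Qed.

Lemma trivIset_order_cell D : trivIset D order_cell.
Proof. by move=> c c' _ _ [x [[_ /= <-] [_ /= <-]]]. Qed.

Lemma order_type_perm_inj : injective (fun s : 'S_N => order_type (fun i => s i : nat)).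
Proof.
move=> s s' /ffunP ss'.
have rank (u : 'S_N) i : u i = #|[pred j | (u j < u i)%N]| :> nat.
  rewrite -sum1_card (reindex_inj (@perm_inj _ u^-1%g)) /=.
  under eq_bigl => j do rewrite inE permKV.
  by rewrite (big_ord_narrow (ltnW (ltn_ord (u i)))) sum_nat_const card_ord muln1.
apply/permP => i; apply/val_inj; rewrite /= rank [RHS]rank.
by apply: eq_card => j; rewrite !inE; have := ss' (j, i); rewrite !ffunE /= !ltEnat.
Qed.

(* Cells of the grid of mesh 1/M whose indices are in the prescribed strict order
   lie in the cell of [s]. These lower bounds tend to 1/N!, and there are N! disjoint
   cells in a cube of volume 1, so they are sharp and ties need no treatment. *)
Lemma order_cell_grid_le (s : 'S_N) (M : nat) : (0 < M)%N ->
  (('C(M, N)%:R / M%:R ^+ N)%:E <= mu (order_cell (order_type (fun i => s i : nat))))%E.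
Proof.
move=> M0; have M0R : 0 < M%:R :> R by rewrite ltr0n.
pose P := [pred e : N.-tuple 'I_M | sorted ltn (map val e)].
pose box (e : N.-tuple 'I_M) (i : 'I_N) : set R :=
  `[(tnth e (s i))%:R / M%:R, (tnth e (s i)).+1%:R / M%:R[%classic.
pose F e : set RN := [set x | forall i, box e i (tnth x i)].
have boxP e i (x : R) : box e i x <->
    (tnth e (s i))%:R <= x * M%:R /\ x * M%:R < (tnth e (s i)).+1%:R.
  rewrite /box /= in_itv /= ler_pdivrMr// ltr_pdivlMr//.
  by split=> [/andP|] //; case=> -> ->.
have mF e : measurable (F e).
  rewrite (_ : F e = \bigcap_(i in [set: 'I_N]) (@tnth _ _ ^~ i @^-1` box e i)).
    apply: fin_bigcap_measurable => [|i _]; first exact: finite_finset.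
    by rewrite -[X in measurable X]setTI; apply: measurable_tnth => //; exact: measurable_itv.
  by apply/seteqP; split => [x Bx i _|x Bx i]; [exact: Bx|exact: Bx].
have muF e : mu (F e) = ((M%:R ^+ N)^-1)%:E.
  rewrite lebesgue_tuple_box; last by move=> i; exact: measurable_itv.
  transitivity (\prod_(i < N) (M%:R^-1 : R)%:E)%E.
    apply: eq_bigr => i _; rewrite lebesgue_measure_itv /= lte_fin ltr_pM2r ?invr_gt0//.
    by rewrite ltr_nat ltnSn -EFinB -mulrBl -natrB// subSnn mul1r.
  rewrite prodEFin; congr _%:E.
  by rewrite prodr_const card_ord exprVn.
have e_incr (e : N.-tuple 'I_M) : P e -> forall i j : 'I_N, (i < j)%N -> (tnth e i < tnth e j)%N.
  move=> eP i j ij; have i0 : 'I_M := tnth e i.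
  have := sorted_ltn_nth ltn_trans (val i0) eP => /(_ i j).
  by rewrite !inE !size_map size_tuple !ltn_ord !(nth_map i0) ?size_tuple// -!tnth_nth; exact.
have tF : trivIset [set e | P e] F.
  move=> e e' _ _ [x [xe xe']]; apply: eq_from_tnth => i.
  rewrite -(permKV s i); set j := _ i.
  have /boxP[a1 a2] := xe j; have /boxP[b1 b2] := xe' j.
  apply/val_inj/anti_leq/andP; split; rewrite -ltnS -(ltr_nat R).
    exact: le_lt_trans a1 b2.
  exact: le_lt_trans b1 a2.
have subF : \bigcup_(e in [set e | P e]) F e `<=` order_cell (order_type (fun i => s i : nat)).
  move=> x [e /= eP xe]; split=> [i|/=].
    have /boxP[a1 a2] := xe i; apply/andP; split.
      by rewrite -(pmulr_lge0 _ M0R) (le_trans _ a1).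
    rewrite -(ltr_pM2r M0R) mul1r (lt_le_trans a2)// ler_nat; exact: ltn_ord.
  have lt_x i j : (s i < s j)%N -> (tnth x i : R) < tnth x j.
    move=> ij; have /boxP[_ a2] := xe i; have /boxP[b1 _] := xe j.
    rewrite -(ltr_pM2r M0R) (lt_le_trans a2)// (le_trans _ b1)// ler_nat.
    exact: e_incr.
  apply/ffunP => -[i j]; rewrite !ffunE /= ltEnat.
  transitivity (s i < s j)%N; last by [].
  case: (ltngtP (s i) (s j)) => [/lt_x ->//|/lt_x ji|/val_inj/perm_inj ->].
    exact: lt_gtF.
  exact: ltxx.
have mB : measurable (\bigcup_(e in [set e | P e]) F e).
  by apply: fin_bigcup_measurable => [|e _]; [exact: finite_finset|exact: mF].
apply: le_trans (le_measure mu (mem_set mB) (mem_set (measurable_order_cell _)) subF).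
have muB : mu (\bigcup_(e in [set e | P e]) F e) = (\sum_(e | P e) mu (F e))%E.
  by apply: measure_finType_bigcup => // e _; exact: mF.
rewrite [leRHS]muB (eq_bigr (fun=> ((M%:R ^+ N)^-1)%:E)) => [|e _]; last exact: muF.
rewrite sumEFin lee_fin sumr_const -card_ltn_sorted_tuples.
rewrite [#|P|](_ : _ = #|[set t : N.-tuple 'I_M | sorted ltn (map val t)]%SET|) ?cardsE//.
by rewrite mulr_natl.
Qed.

(** Makes the grid bound C(M, N) / M^N tend to 1 / N!. The factor M - K loses at most K / M relative
    to M, and the losses for K < N add up to less than the crude N^2 / M. *)
Lemma ffact_ge (M : nat) : (0 < M)%N ->
  1 - N%:R ^+ 2 / M%:R <= (M ^_ N)%:R / M%:R ^+ N :> R.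
Proof.
move=> M0; have M0R : 0 < M%:R :> R by rewrite ltr0n.
elim: N => [|K IH]; first by rewrite expr0n /= mul0r subr0 ffactn0 divr1.
have p0 : 0 <= (M ^_ K)%:R / M%:R ^+ K :> R by rewrite divr_ge0// exprn_ge0.
have p1 : (M ^_ K)%:R / M%:R ^+ K <= 1 :> R.
  rewrite ler_pdivrMr ?exprn_gt0// mul1r -natrX ler_nat.
  elim: K {IH p0} => // K IH; rewrite ffactnSr expnSr leq_mul//; exact: leq_subr.
have q : 1 - K%:R / M%:R <= (M - K)%:R / M%:R :> R.
  rewrite -[X in X - _](@divff _ (M%:R : R)) ?gt_eqF// -mulrBl ler_pM2r ?invr_gt0//.
  have [KM|MK] := leqP K M; first by rewrite natrB.
  by rewrite (le_trans _ (ler0n _ _))// subr_le0 ler_nat ltnW.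
rewrite ffactnSr natrM [M%:R ^+ K.+1]exprSr invfM mulrACA.
apply: le_trans (ler_wpM2l p0 q).
set p := (M ^_ K)%:R / M%:R ^+ K in IH p0 p1 *; set x := K%:R / M%:R.
have x0 : 0 <= x by rewrite divr_ge0.
have -> : K.+1%:R ^+ 2 / M%:R = K%:R ^+ 2 / M%:R + x + x + M%:R^-1 :> R.
  by rewrite /x -natr1; field; rewrite gt_eqF.
have i0 : 0 < M%:R^-1 :> R by rewrite invr_gt0.
have px : 0 <= (1 - p) * x by rewrite mulr_ge0// subr_ge0.
move: IH i0; set y := K%:R ^+ 2 / _; set z := M%:R^-1 => IH i0.
lra.
Qed.

Lemma order_cell_ge (s : 'S_N) :
  ((N`!%:R^-1)%:E <= mu (order_cell (order_type (fun i => s i : nat))))%E.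
Proof.
set m := mu _.
have f0 : 0 < N`!%:R :> R by rewrite ltr0n fact_gt0.
have m0 : (0 <= m)%E by exact: measure_ge0.
move: m0; case Em : m => [r| |] // _; last by rewrite leey.
rewrite lee_fin leNgt; apply/negP => ltr.
pose d := 1 - r * N`!%:R.
have d0 : 0 < d by rewrite subr_gt0 -ltr_pdivlMr// mul1r.
(* The mesh is chosen so that the error N^2 / M of [ffact_ge] is below the assumed defect [d]. *)
pose M := (Num.truncn (N%:R ^+ 2 / d)).+1.
have NM : N%:R ^+ 2 / M%:R < d.
  by rewrite ltr_pdivrMr// mulrC -ltr_pdivrMr// truncnS_gt.
have := order_cell_grid_le s (isT : (0 < M)%N); rewrite -/m Em lee_fin => H.
have := ffact_ge (isT : (0 < M)%N).
rewrite -bin_ffact natrM => h; have := ler_wpM2r (ltW f0) H.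
rewrite mulrAC => /(le_trans h).
by rewrite /d in NM; lra.
Qed.

Theorem lebesgue_tuple_order_type (Q : pred {ffun 'I_N * 'I_N -> bool}) :
  mu (cube `&` [set x | Q (order_type (tnth x : 'I_N -> R))]) =
  (#|[set s : 'S_N | Q (order_type (fun i => s i : nat))]%SET|%:R / N`!%:R)%:E.
Proof.
have sumQ (Q' : pred {ffun 'I_N * 'I_N -> bool}) :
    mu (cube `&` [set x | Q' (order_type (tnth x : 'I_N -> R))]) =
    (\sum_(c | Q' c) mu (order_cell c))%E.
  rewrite -measure_finType_bigcup; last first.
  - exact: trivIset_order_cell.
  - by move=> c _; exact: measurable_order_cell.
  congr (mu _); apply/seteqP; split => [x [xc Qx]|x [c /= Qc [xc xE]]].
    by exists (order_type (tnth x : 'I_N -> R)).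
  by split => //=; rewrite xE.
pose m c := fine (mu (order_cell c)).
have mE c : mu (order_cell c) = (m c)%:E.
  rewrite fineK// ge0_fin_numE; last exact: measure_ge0.
  apply: (@le_lt_trans _ _ (mu cube)); last by rewrite [X in (X < _)%E]lebesgue_tuple_cube ltry.
  apply: le_measure; rewrite ?inE; [exact: measurable_order_cell|exact: measurable_cube|].
  by apply: subIsetl.
have sum_m : \sum_c m c = 1.
  apply: EFin_inj; rewrite -sumEFin -lebesgue_tuple_cube.
  under eq_bigr do rewrite -mE.
  rewrite -(sumQ xpredT); congr (mu _).
  by apply/seteqP; split => // x [].
have m_ge (Q' : pred {ffun 'I_N * 'I_N -> bool}) :
    #|[set s : 'S_N | Q' (order_type (fun i => s i : nat))]%SET|%:R / N`!%:R <=
    \sum_(c | Q' c) m c.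
  pose ot (s : 'S_N) := order_type (fun i => s i : nat).
  apply: (@le_trans _ _ (\sum_(c in ot @: [set s | Q' (ot s)]%SET) m c)); last first.
    rewrite [leRHS](bigID (mem (ot @: [set s | Q' (ot s)]%SET))) /=.
    rewrite [X in _ <= X + _](eq_bigl (fun c => c \in ot @: [set s | Q' (ot s)]%SET)) => [|c]; last first.
      by apply: andb_idl => /imsetP[s]; rewrite inE => + ->.
    by rewrite lerDl; apply: sumr_ge0 => c _; exact/fine_ge0/measure_ge0.
  rewrite big_imset /=; last by move=> s s' _ _; exact: order_type_perm_inj.
  rewrite mulr_natl -sumr_const; apply: ler_sum => s _.
  by rewrite -lee_fin -mE; exact: order_cell_ge.
rewrite sumQ; under eq_bigr do rewrite mE.
rewrite sumEFin; congr _%:E; apply/eqP; rewrite eq_le m_ge andbT.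
(* The lower bounds for [Q] and for its complement add up to the total mass 1, so both are
   equalities. *)
have := m_ge (predC Q); have := sum_m; rewrite (bigID Q) /=.
set S := [set s : 'S_N | predC Q _]%SET; set S' := [set s : 'S_N | Q _]%SET.
have -> : S = (~: S')%SET by apply/setP => s; rewrite !inE.
have cS : #|S'|%:R + #|(~: S')%SET|%:R = N`!%:R :> R by rewrite -natrD cardsC card_Sn.
have f0 : N`!%:R != 0 :> R by rewrite pnatr_eq0 -lt0n fact_gt0.
have : #|S'|%:R / N`!%:R + #|(~: S')%SET|%:R / N`!%:R = 1 :> R.
  by rewrite -mulrDl cS divff.
lra.
Qed.

End OrderTypes.

Lemma bead_volumeE (R : realType) (n k l : nat) : (0 < n)%N -> (l <= n)%N ->
  bead_volume R n k l =
  (\sum_(Y : {set 'I_n} | #|Y| == n - l) walks (n * k) Y Y)%N%:R / (n * k)`!%:R :> R.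
Proof.
move=> n0 ln; rewrite /bead_volume; case: eqVneq => [->|k0].
  (* For k = 0 the convention agrees with the formula: the empty word closes up from every set of n
     - l holes. *)
  rewrite muln0 divr1 (eq_bigr (fun=> 1%N)); last by move=> Y _; rewrite walks0 eqxx.
  rewrite sum1_card -(bin_sub ln) -[X in 'C(X, _)]card_ord -card_draws.
  by congr _%:R; apply: eq_card => Y; rewrite !inE.
have {}k0 : (0 < k)%N by rewrite lt0n.
pose Q (c : {ffun 'I_(n * k) * 'I_(n * k) -> bool}) := bead_pattern l
  (fun p q : 'I_n * 'I_k => c (mxvec_index p.1 p.2, mxvec_index q.1 q.2)).
have -> : @array_of_tuple R n k @^-1` nkl_config l =
    @cube R (n * k) `&` [set x | Q (order_type (tnth x : _ -> R))].
  have relE x : array_rel (@array_of_tuple R n k x) = (fun p q : 'I_n * 'I_k =>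
      order_type (tnth x : _ -> R) (mxvec_index p.1 p.2, mxvec_index q.1 q.2)).
    by apply/funext => p; apply/funext => q; rewrite /array_rel !mxE ffunE.
  apply/seteqP; split => [x /= /(nkl_configP _ _ k0)[x01]|x /= [x01 Qx]].
    rewrite relE => Qx; split=> // i; rewrite -(mxvec_splitK i).
    by have := x01 (mxvec_split i).1 (mxvec_split i).2; rewrite mxE.
  apply/(nkl_configP _ _ k0); rewrite relE; split => // h i.
  by rewrite mxE; exact: x01.
rewrite lebesgue_tuple_order_type /= -(card_bead_pattern n0 k0 ln).
congr (_%:R / _); apply: eq_card => s; rewrite !inE /Q.
by congr bead_pattern; apply/funext => p; apply/funext => q; rewrite ffunE.
Qed.

(** * The complex exponential series *)

Section ExponentialSums.
Variable K : numFieldType.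
Local Open Scope ring_scope.

Definition exp_sum (M : nat) (z : K) : K := \sum_(i < M) z ^+ i / i`!%:R.

(** The right side is the triangle i + j < M of the product of the two truncated series; the rest of
    the square is the error estimated next. *)
Lemma exp_sumD M (a b : K) : exp_sum M (a + b) =
  \sum_(i < M) \sum_(j < M - i) (a ^+ i / i`!%:R) * (b ^+ j / j`!%:R).
Proof.
elim: M => [|M IH]; first by rewrite /exp_sum !big_ord0.
rewrite /exp_sum big_ord_recr /= -/(exp_sum M _) IH [RHS]big_ord_recr /=.
rewrite subSnn big_ord1.
under [X in _ = X + _]eq_bigr => i _ do rewrite (subSn (ltnW (ltn_ord i))) big_ord_recr /=.
rewrite big_split /= -addrA; congr (_ + _).
pose A i := a ^+ i / i`!%:R; pose B i := b ^+ i / i`!%:R.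
transitivity (\sum_(i < M.+1) A i * B (M - i)%N); last by rewrite big_ord_recr /= subnn.
rewrite addrC exprDn mulr_suml; apply: eq_bigr => i _.
have iM : (i <= M)%N by rewrite -ltnS.
have f0 j : j`!%:R != 0 :> K by rewrite pnatr_eq0 -lt0n fact_gt0.
rewrite -(bin_fact iM) /A /B !natrM -mulr_natr.
have c0 : 'C(M, i)%:R != 0 :> K by rewrite pnatr_eq0 -lt0n bin_gt0.
by field; rewrite !f0 c0.
Qed.

(* The error is a sum of monomials, so that it is dominated by its value at the
   moduli, which tends to 0 by the functional equation of the real exponential. *)
Lemma exp_sum_mul_near M (a b : K) :
  `|exp_sum M (a + b) - exp_sum M a * exp_sum M b| <=
  exp_sum M `|a| * exp_sum M `|b| - exp_sum M (`|a| + `|b|).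
Proof.
have E (x y : K) : exp_sum M x * exp_sum M y - exp_sum M (x + y) =
    \sum_(i < M) \sum_(M - i <= j < M) (x ^+ i / i`!%:R) * (y ^+ j / j`!%:R).
  rewrite exp_sumD {1}/exp_sum mulr_suml -sumrB; apply: eq_bigr => i _.
  rewrite /exp_sum mulr_sumr -(big_mkord xpredT (fun j => x ^+ i / i`!%:R * (y ^+ j / j`!%:R))).
  rewrite (big_cat_nat (leq0n (M - i)) (leq_subr i M)) /= big_mkord.
  by rewrite [LHS]addrC addKr.
rewrite distrC !E; apply: le_trans (ler_norm_sum _ _ _) _; apply: ler_sum => i _.
apply: le_trans (ler_norm_sum _ _ _) _; apply: ler_sum => j _.
by rewrite !normrM !normfV !normrX !normr_nat.
Qed.

End ExponentialSums.

Section ComplexExponential.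
Variable R : realType.

Lemma cvg_of_complex_bound (f : nat -> R[i]^o) (L : R[i]^o) (r : R^nat) :
  (forall n, `|L - f n| <= (r n)%:C%C) -> r @ \oo --> 0 -> f @ \oo --> L.
Proof.
(* In the order of [R[i]] a positive [e] has zero imaginary part, so the bound reduces to a real
   one. *)
move=> fr r0; apply/cvgrPdist_lt => e; rewrite ltcE /= => /andP[/eqP e0 e1].
have eE : e = (complex.Re e)%:C%C by case: e e0 {e1} => x y /= ->.
have /cvgrPdist_lt/(_ _ e1) := r0.
apply: filterS => n; rewrite sub0r normrN => rn.
rewrite eE; apply: le_lt_trans (fr n) _; rewrite ltcR.
exact: le_lt_trans (ler_norm _) rn.
Qed.

Lemma exp_sum_real (M : nat) (x : R) : exp_sum M x%:C%C = (exp_sum M x)%:C%C.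
Proof.
rewrite /exp_sum rmorph_sum /=; apply: eq_bigr => i _.
by rewrite rmorphM /= rmorphXn fmorphV /= rmorph_nat.
Qed.

Lemma exp_sumE (x : R) : (fun M => exp_sum M x) = series (exp_coeff x).
Proof. by apply/funext => M; rewrite /series /= big_mkord. Qed.

Lemma exp_sum_imag (M : nat) (y : R) : exp_sum M (0 +i* y)%C =
  (series (cos_coeff y) M +i* series (sin_coeff y) M)%C.
Proof.
have iE : (0 +i* y)%C = y%:C%C * 'i%C.
  by apply/eqP; rewrite eq_complex /= !(mulr0, mul0r, mulr1) subrr addr0 !eqxx.
(* Powers of i in the shape of [cos_coeff] and [sin_coeff]; at N = 0 the truncated [N.-1] does no
   harm, its factor [odd N] being 0. *)
have iX N : 'i%C ^+ N = ((~~ odd N)%:R * (-1) ^+ N./2 +i* ((odd N)%:R * (-1) ^+ N.-1./2))%C :> R[i].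
  have i2 : 'i%C ^+ 2 = (-1)%:C%C :> R[i].
    by rewrite expr2; apply/eqP; rewrite eq_complex /=; apply/andP; split; apply/eqP; ring.
  rewrite -{1}[N]odd_double_half -muln2 mulnC exprD exprM i2 -rmorphXn /=.
  case: N => [|N] /=.
    by apply/eqP; rewrite eq_complex /=; apply/andP; split; apply/eqP; ring.
  rewrite uphalf_half; case: (odd N) => /=;
  by apply/eqP; rewrite eq_complex /=; apply/andP; split; apply/eqP; ring.
rewrite /exp_sum /series /= !big_mkord.
elim: M => [|M IH]; first by rewrite !big_ord0.
rewrite !big_ord_recr /= IH iE exprMn iX -rmorphXn.
rewrite -(rmorph_nat (real_complex R)) -fmorphV /=.
apply/eqP; rewrite eq_complex /=.
apply/andP; split; apply/eqP; rewrite ?(mul0r, mulr0, subr0, add0r, addr0); congr (_ + _).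
  by rewrite /cos_coeff /= [y ^+ M * _]mulrC.
by rewrite /sin_coeff /= [y ^+ M * _]mulrC.
Qed.

Lemma normc_re_im (a b : R) : `|(a +i* b)%C| <= (`|a| + `|b|)%:C%C.
Proof.
rewrite normc_def lecR /= -[leRHS]ger0_norm ?addr_ge0// -sqrtr_sqr ler_wsqrtr//.
rewrite sqrrD !real_normK ?num_real// addrAC lerDl.
by rewrite mulrn_wge0// mulr_ge0.
Qed.

Lemma normc_real (a : R) : `|a%:C%C| = `|a|%:C%C.
Proof. by rewrite normc_def /= expr0n addr0 sqrtr_sqr. Qed.

Lemma normc_imag (b : R) : `|(0 +i* b)%C| = `|b|%:C%C.
Proof. by rewrite normc_def /= expr0n add0r sqrtr_sqr. Qed.

(** As [cexp] is built from [expR], [cos] and [sin], the truncated series at x + iy is compared with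
    the product of those at x and iy, whose limits are known. *)
Lemma cvg_exp_sum (z : R[i]) :
  (fun M => exp_sum M z : R[i]^o) @ \oo --> (cexp z : R[i]^o).
Proof.
case: z => x y.
pose u : R^nat := fun M => exp_sum M `|x| * exp_sum M `|y| - exp_sum M (`|x| + `|y|).
pose e : R^nat := fun M => exp_sum M x.
pose c : R^nat := series (cos_coeff y); pose s : R^nat := series (sin_coeff y).
pose r : R^nat := fun M => `|expR x * cos y - e M * c M| + `|expR x * sin y - e M * s M| + u M.
have cvg_e (v : R) : (fun M => exp_sum M v) @ \oo --> expR v.
  by rewrite exp_sumE; exact: is_cvg_series_exp_coeff.
have cvg_c : c @ \oo --> cos y by rewrite unlock; exact: is_cvg_series_cos_coeff.
have cvg_s : s @ \oo --> sin y by rewrite unlock; exact: is_cvg_series_sin_coeff.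
apply: (@cvg_of_complex_bound _ _ r) => [M|].
  have zE : (x +i* y)%C = x%:C%C + (0 +i* y)%C by apply/eqP; rewrite eq_complex /= addr0 add0r !eqxx.
  pose P := (e M * c M +i* (e M * s M))%C.
  have PE : P = exp_sum M x%:C%C * exp_sum M (0 +i* y)%C.
    by rewrite exp_sum_real exp_sum_imag /P; apply/eqP; rewrite eq_complex /= !mul0r subr0 addr0 !eqxx.
  apply: le_trans (ler_distD P _ _) _; rewrite /r rmorphD; apply: lerD.
    rewrite (_ : cexp _ - P = ((expR x * cos y - e M * c M) +i* (expR x * sin y - e M * s M))%C).
      exact: normc_re_im.
    by apply/eqP; rewrite eq_complex /cexp /P /= !mul0r subr0 addr0 !eqxx.
  rewrite PE distrC zE; apply: le_trans (exp_sum_mul_near _ _ _) _.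
  by rewrite normc_real normc_imag -rmorphD !exp_sum_real -rmorphM -rmorphB.
(* Zero is rewritten as the termwise limit of [r]; its last summand vanishes by the real functional
   equation. *)
have -> : 0 = `|expR x * cos y - expR x * cos y| + `|expR x * sin y - expR x * sin y| +
    (expR `|x| * expR `|y| - expR (`|x| + `|y|)) :> R.
  by rewrite expRD !subrr normr0 !addr0.
apply: cvgD; first apply: cvgD.
- by apply: cvg_norm; apply: cvgB; [exact: cvg_cst|apply: cvgM; [exact: cvg_e|]].
- by apply: cvg_norm; apply: cvgB; [exact: cvg_cst|apply: cvgM; [exact: cvg_e|]].
- by apply: cvgB; [apply: cvgM; exact: cvg_e|exact: cvg_e].
Qed.

End ComplexExponential.

(** The solutions are one n-th root of [c] times the n-th roots of unity, which are distinct because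
    X^n - 1 is separable in characteristic 0. *)
Lemma roots_enum (F : numClosedFieldType) (n : nat) (c : F) : (0 < n)%N -> c != 0 ->
  exists w : 'I_n -> F, [/\ injective w, forall i, w i ^+ n = c
    & forall z, z ^+ n = c -> exists i, z = w i].
Proof.
move=> n0 c0.
have [r rE] := closed_field_poly_normal ('X^n - 1%:P : {poly F}).
rewrite (monicP (monicXnsubC 1 n0)) scale1r in rE.
have ur : uniq r.
  by rewrite -separable_prod_XsubC -rE polyC1 separable_Xn_sub_1 // pnatr_eq0 -lt0n.
have sr : size r = n.
  by apply: succn_inj; rewrite -(size_prod_XsubC r idfun) -rE size_XnsubC.
have mem_r z : (z \in r) = (z ^+ n == 1).
  by rewrite -root_prod_XsubC -rE rootE !hornerE subr_eq0.
pose w0 := n.-root c.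
have w0n : w0 ^+ n = c by rewrite /w0 rootCK.
have w0_neq0 : w0 != 0 by apply: contraNneq c0 => w00; rewrite -w0n w00 expr0n gtn_eqF.
exists (fun i : 'I_n => w0 * r`_i); split.
- move=> i j /(mulfI w0_neq0) /eqP; rewrite nth_uniq ?sr// => /eqP ij.
  exact: val_inj.
- move=> i; have : r`_i \in r by rewrite mem_nth// sr.
  by rewrite mem_r exprMn w0n => /eqP ->; rewrite mulr1.
- move=> z zc; have : z / w0 \in r.
    by rewrite mem_r exprMn exprVn zc w0n divff.
  case/(nthP 0) => i; rewrite sr => ir iz; exists (Ordinal ir) => /=.
  by rewrite iz mulrC divfK.
Qed.

Section ComplexExpTheory.
Variable R : realType.
Implicit Types z w : R[i].

Lemma cexpD z w : cexp (z + w) = cexp z * cexp w.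
Proof.
case: z w => [a b] [c d]; rewrite /cexp /= expRD cosD sinD.
by apply/eqP; rewrite eq_complex /=; apply/andP; split; apply/eqP; ring.
Qed.

Lemma cexp0 : cexp 0 = 1 :> R[i].
Proof.
by rewrite /cexp /= expR0 cos0 sin0; apply/eqP; rewrite eq_complex /=;
  apply/andP; split; apply/eqP; ring.
Qed.

Lemma cexp_sum (I : finType) (P : pred I) (f : I -> R[i]) :
  cexp (\sum_(i | P i) f i) = \prod_(i | P i) cexp (f i).
Proof. exact: (big_morph _ cexpD cexp0). Qed.

Lemma cexpMn z l : cexp (z * l%:R) = cexp z ^+ l.
Proof.
elim: l => [|l IH]; first by rewrite mulr0 cexp0.
by rewrite -natr1 mulrDr mulr1 cexpD IH exprSr.
Qed.

End ComplexExpTheory.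

Lemma sum_multiples (V : nmodType) (n K : nat) (a : nat -> V) : (0 < n)%N ->
  (forall N, ~~ (n %| N)%N -> a N = 0) ->
  \sum_(N < n * K) a N = \sum_(k < K) a (n * k)%N.
Proof.
move=> n0 a0; elim: K => [|K IH]; first by rewrite muln0 !big_ord0.
rewrite big_ord_recr /= -IH mulnS addnC big_split_ord /=; congr (_ + _).
case: n n0 a0 {IH} => // n _ a0; rewrite big_ord_recl /= addn0 big1 ?addr0// => i _.
apply: a0; rewrite dvdn_addr ?dvdn_mulr//; apply/negP => /dvdn_leq.
by rewrite /bump leq0n add1n => /(_ isT); rewrite ltnS leqNgt ltn_ord.
Qed.


Lemma cvgr_sum (K : numFieldType) (V : normedModType K) (I : Type) (r : seq I) (P : pred I)
    (f : I -> nat -> V) (a : I -> V) :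
  (forall i, P i -> f i @ \oo --> a i) ->
  (fun N => \sum_(i <- r | P i) f i N) @ \oo --> \sum_(i <- r | P i) a i.
Proof.
move=> fa; elim: r => [|i r IH].
  by rewrite big_nil; under eq_fun do rewrite big_nil; exact: cvg_cst.
rewrite big_cons; under eq_fun do rewrite big_cons.
by case: ifP => // Pi; apply: cvgD; [exact: fa|exact: IH].
Qed.

(** * The generating function *)

Section GeneratingFunction.
Variables (R : realType) (n : nat).
Hypothesis n_gt0 : (0 < n)%N.
Local Notation C := R[i].

Definition esym_exp (T : C) (m : nat) (w : 'I_n -> C) : C :=
  \sum_(J : {set 'I_n} | #|J| == m) \prod_(i in J) cexp (T * w i).

Lemma cvg_closed_walks (T : C) (m : nat) (w : 'I_n -> C) :
  injective w -> (forall i, w i ^+ n = (-1) ^+ m.+1) ->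
  (fun K => \sum_(k < K) T ^+ (n * k) / (n * k)`!%:R *
    \sum_(Y : {set 'I_n} | #|Y| == m) (walks (n * k) Y Y)%:R : C^o) @ \oo -->
  (esym_exp T m w : C^o).
Proof.
move=> w_inj w_pow.
have -> : (fun K => \sum_(k < K) T ^+ (n * k) / (n * k)`!%:R *
    \sum_(Y : {set 'I_n} | #|Y| == m) (walks (n * k) Y Y)%:R : C^o) =
  (fun K => \sum_(J : {set 'I_n} | #|J| == m) exp_sum (n * K) (T * \sum_(i in J) w i) : C^o).
  apply/funext => K.
  (* Walks of length not divisible by [n] are put back in, at no cost, to obtain complete truncated
     exponentials of order n K. *)
  pose a N : C := T ^+ N / N`!%:R * \sum_(Y : {set 'I_n} | #|Y| == m) (walks N Y Y)%:R.
  rewrite -(sum_multiples K (a := a)) //; last first.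
    by move=> N nN; rewrite /a big1 ?mulr0// => Y _; rewrite walks_closed_dvdn.
  rewrite /exp_sum exchange_big /=; apply: eq_bigr => N _.
  rewrite /a (sum_closed_walks w_inj w_pow) mulr_sumr; apply: eq_bigr => J _.
  by rewrite exprMn mulrAC.
rewrite /esym_exp; under eq_bigr => J _ do rewrite -cexp_sum -mulr_sumr.
have cvg_J := @cvgr_sum _ C^o _ (index_enum _) (fun J : {set 'I_n} => #|J| == m) (fun J K => exp_sum (n * K) (T * \sum_(i in J) w i))
  (fun J => cexp (T * \sum_(i in J) w i)).
refine (cvg_J _) => J _.
have nK : (fun K => n * K)%N @ \oo --> \oo.
  apply/cvgnyPge => A; near=> K; rewrite (@leq_trans K)//; last by rewrite leq_pmull.
  by near: K; exact: nbhs_infty_ge.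
exact: (cvg_comp _ _ nK (@cvg_exp_sum R (T * \sum_(i in J) w i))).
Unshelve. all: by end_near. Qed.

(** The roots depend on [l] because the number n - l of holes decides the twist. *)
Lemma cvg_bead_series (lambda T : C) (w : 'I_n.+1 -> 'I_n -> C) :
  (forall l, injective (w l)) -> (forall l i, w l i ^+ n = (-1) ^+ (n - l).+1) ->
  series (fun k : nat => \sum_(l < n.+1) T ^+ (n * k) * cexp (- lambda * l%:R) *
      (bead_volume R n k l)%:C%C : C^o) @ \oo -->
  (\sum_(l < n.+1) cexp (- lambda) ^+ l * esym_exp T (n - l) (w l) : C^o).
Proof.
move=> w_inj w_pow.
rewrite (_ : series _ = (fun K => \sum_(l < n.+1) cexp (- lambda) ^+ l *
  (\sum_(k < K) T ^+ (n * k) / (n * k)`!%:R *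
    \sum_(Y : {set 'I_n} | #|Y| == (n - l)%N) (walks (n * k) Y Y)%:R) : C^o)).
  have cvg_l := @cvgr_sum _ C^o _ (index_enum _) xpredT (fun (l : 'I_n.+1) K => cexp (- lambda) ^+ l *
    (\sum_(k < K) T ^+ (n * k) / (n * k)`!%:R *
      \sum_(Y : {set 'I_n} | #|Y| == (n - l)%N) (walks (n * k) Y Y)%:R))
    (fun l => cexp (- lambda) ^+ l * esym_exp T (n - l) (w l)).
  refine (cvg_l _) => l _.
  by apply: cvgM; [exact: cvg_cst|exact: cvg_closed_walks].
apply/funext => K; rewrite /series /= big_mkord exchange_big /=; apply: eq_bigr => l _.
rewrite mulr_sumr; apply: eq_bigr => k _.
rewrite bead_volumeE// -1?ltnS// rmorphM /= fmorphV /= !rmorph_nat natr_sum cexpMn.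
by ring.
Qed.

(** In the expanded product, [J] is the set of factors contributing their exponential; it
    corresponds to the momenta of the n - l holes, the other [l] factors giving - z. *)
Lemma prod_exp_sub (T z : C) (w : 'I_n -> C) :
  \prod_i (cexp (T * w i) - z) =
  \sum_(l < n.+1) (- z) ^+ l * esym_exp T (n - l) w.
Proof.
rewrite bigA_distr /=.
rewrite (partition_big (fun J : {set 'I_n} => inord (n - #|J|) : 'I_n.+1) xpredT) //=.
apply: eq_bigr => l _; rewrite /esym_exp mulr_sumr.
have ln : (l <= n)%N by rewrite -ltnS.
have cJ (J : {set 'I_n}) : (#|J| <= n)%N by rewrite -[X in (_ <= X)%N]card_ord max_card.
have lE (J : {set 'I_n}) : (inord (n - #|J|) == l :> 'I_n.+1) = (#|J| == n - l)%N.
  rewrite -(inj_eq val_inj) /= inordK ?ltnS ?leq_subr//.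
  by have := cJ J; move: #|J| => c cn; apply/eqP/eqP; lia.
apply: eq_big => [J|J]; first exact: lE.
rewrite lE => /eqP Jl; rewrite (bigID (mem J)) /= mulrC; congr (_ * _).
  rewrite (eq_bigr (fun=> - z)) => [|i /negbTE -> //].
  rewrite prodr_const; congr (_ ^+ _).
  have -> : (l = n - #|J| :> nat)%N by rewrite Jl subKn.
  by rewrite -[X in (X - _)%N]card_ord -(cardC (mem J)) addKn.
by apply: eq_bigr => i ->.
Qed.

(* Only the sector with [theta2] of the parity of [n + l + 1] survives the sum
   over [theta1]. *)
Lemma sum_sectors (z : C) (D : 'I_2 -> nat -> C) :
  2^-1 * \sum_(theta : 'I_2 * 'I_2) (-1) ^+ ((theta.1 + 1) * (theta.2 + n + 1)) *
    (\sum_(l < n.+1) (- ((-1) ^+ theta.1 * z)) ^+ l * D theta.2 (n - l)%N) =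
  \sum_(l < n.+1) z ^+ l * D (inord (odd (n + l + 1))) (n - l)%N.
Proof.
rewrite -(pair_bigA _ (fun t1 t2 : 'I_2 => (-1) ^+ ((t1 + 1) * (t2 + n + 1)) *
  (\sum_(l < n.+1) (- ((-1) ^+ t1 * z)) ^+ l * D t2 (n - l)%N))) /=.
under eq_bigr => t1 _ do under eq_bigr => t2 _ do rewrite mulr_sumr.
under eq_bigr => t1 _ do rewrite exchange_big /=.
rewrite exchange_big /= mulr_sumr; apply: eq_bigr => l _.
have term (t1 t2 : 'I_2) : (-1) ^+ ((t1 + 1) * (t2 + n + 1)) *
    ((- ((-1) ^+ t1 * z)) ^+ l * D t2 (n - l)%N) =
    (-1) ^+ ((t1 + 1) * (t2 + (n + l + 1))) * (z ^+ l * D t2 (n - l)%N).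
  rewrite -[- (_ * z)]mulN1r [-1 * (_ * z)]mulrA -exprS exprMn -exprM !mulrA -exprD.
  congr (_ ^+ _ * _ * _); rewrite -[t1.+1]addn1 -mulnDr; congr (_ * _)%N; lia.
under eq_bigr => t1 _ do under eq_bigr => t2 _ do rewrite term.
have sum2 (F : 'I_2 -> C) : \sum_t F t = F (inord 0) + F (inord 1).
  by rewrite !big_ord_recl big_ord0 addr0; congr (F _ + F _); apply/val_inj; rewrite /= inordK.
have h2 : 2%:R != 0 :> C by rewrite pnatr_eq0.
have e2 x : (-1) ^+ ((1 + 1) * x) = 1 :> C by rewrite exprM sqrrN !expr1n.
rewrite !sum2 !inordK//= !add0n !mul1n !e2 !mul1r add1n exprS.
rewrite -[(-1) ^+ (n + l + 1)]signr_odd; case: odd => /=; by field.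
Qed.

End GeneratingFunction.

Unset Implicit Arguments.

Theorem theorem1p2 (R : realType) (n : nat) (hn : (1 <= n)%N)
    (lambda T : R[i]) :
  series (fun k : nat =>
    \sum_(l < n.+1) T ^+ (n * k) * cexp (- lambda * l%:R) *
      (bead_volume R n k l)%:C%C : R[i]^o) @ \oo -->
  (2^-1 * \sum_(theta : 'I_2 * 'I_2)
    (-1) ^+ ((theta.1 + 1) * (theta.2 + n + 1)) *
    \big[*%R/1]_(w \in [set w : R[i] | w ^+ n = (-1) ^+ theta.2])
      (cexp (T * w) - (-1) ^+ theta.1 * cexp (- lambda)) : R[i]^o).
Proof.
have /boolp.choice[w wP] (t : 'I_2) : exists w : 'I_n -> R[i], [/\ injective w,
    forall i, w i ^+ n = (-1) ^+ t & forall z, z ^+ n = (-1) ^+ t -> exists i, z = w i].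
  by apply: roots_enum => //; rewrite signr_eq0.
have prodE (t1 t2 : 'I_2) :
    \big[*%R/1]_(v \in [set v : R[i] | v ^+ n = (-1) ^+ t2])
      (cexp (T * v) - (-1) ^+ t1 * cexp (- lambda)) =
    \prod_i (cexp (T * w t2 i) - (-1) ^+ t1 * cexp (- lambda)).
  have [w_inj w_pow w_all] := wP t2.
  rewrite -[RHS](big_map (w t2) xpredT (fun v => cexp (T * v) - (-1) ^+ t1 * cexp (- lambda))).
  rewrite (fsbigE [seq w t2 i | i <- index_enum 'I_n]).
  - rewrite big_seq_cond [RHS]big_seq; apply: eq_bigl => v; apply: andb_idr.
    by case/mapP => i _ ->; rewrite mem_set//; exact: w_pow.
  - by rewrite map_inj_uniq// index_enum_uniq.
  - by move=> v /= /mapP[i _ ->]; exact: w_pow.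
  - by move=> v /= /w_all[i ->]; rewrite map_f// mem_index_enum.
under eq_bigr => th _ do rewrite prodE prod_exp_sub//.
rewrite (sum_sectors hn _ (fun t m => esym_exp T m (w t))).
(* The surviving sector has theta_2 of the parity of n + l + 1, which is that of (n - l) + 1: the
   twist required by n - l holes. *)
apply: cvg_bead_series => // [l|l i]; first by have [] := wP (inord (odd (n + l + 1))).
have [_ -> _] := wP (inord (odd (n + l + 1))).
have ln : (l <= n)%N by rewrite -ltnS.
rewrite inordK; last by case: odd.
rewrite signr_odd -signr_odd -[RHS]signr_odd; congr (_ ^+ nat_of_bool _).
by rewrite /= oddB// !oddD /= addbT.
Qed.
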